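(* Let $G$ be a finitely generated group which splits as a non-trivial free product of finitely many indecomposable groups. Then $G$ has property $R_\infty$.
   Context: A group is (freely) indecomposable if it is non-trivial and cannot be written as a free product of two non-trivial groups. A free product is non-trivial if it has at least two factors, all of them non-trivial. Twisted conjugacy: for a group $G$ and $\varphi\in\mathrm{Aut}(G)$ (acting on the right), write $x\sim_\varphi y$ if there is $w\in G$ with $(w\varphi)\,x\,w^{-1}=y$; this is an equivalence relation on $G$. $G$ has property $R_\infty(\varphi)$ if $\sim_\varphi$ has infinitely many equivalence classes, and $G$ has property $R_\infty$ if it has $R_\infty(\varphi)$ for every $\varphi\in\mathrm{Aut}(G)$. *)

(* Defs.v *)
From mathcomp Require Import all_boot.
From mathcomp Require Import boolp classical_sets functions cardinality.

Set Implicit Arguments.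
Unset Strict Implicit.
Unset Printing Implicit Defensive.

Local Open Scope classical_set_scope.
Local Open Scope group_scope.

Definition nontrivial (G : groupType) : Prop := exists x : G, x <> 1.

Definition finitely_generated (G : groupType) : Prop :=
  exists s : seq G, forall S : {pred G},
    group_closed S -> {subset s <= S} -> forall x, x \in S.

(* G, with the maps iota i, is the coproduct of the H i in the category of
   groups; the iota i are then automatically injective. *)
Definition is_free_product (G : groupType) (I : Type) (H : I -> groupType)
    (iota : forall i, {multiplicative H i -> G}) : Prop :=
  forall (K : groupType) (f : forall i, {multiplicative H i -> K}),
    exists2 h : {multiplicative G -> K},
      (forall i x, h (iota i x) = f i x) &
      (forall h' : {multiplicative G -> K},
         (forall i x, h' (iota i x) = f i x) -> h' =1 h).

Definition nontrivial_free_product (G : groupType) (I : finType)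
    (H : I -> groupType) (iota : forall i, {multiplicative H i -> G}) : Prop :=
  [/\ (1 < #|I|)%N, forall i, nontrivial (H i) & is_free_product iota].

Definition indecomposable (G : groupType) : Prop :=
  nontrivial G /\
  ~ exists (H : bool -> groupType) (iota : forall b, {multiplicative H b -> G}),
      nontrivial_free_product iota.

(* Automorphisms act on the right in the source, so (w phi) x w^-1 reads
   phi w * x * w^-1. *)
Definition twisted_conj (G : groupType) (phi : G -> G) (x y : G) : Prop :=
  exists w : G, phi w * x * w^-1 = y.

Definition Rinfty_at (G : groupType) (phi : G -> G) : Prop :=
  infinite_set (range (fun x => [set y | twisted_conj phi x y])).

Definition Rinfty (G : groupType) : Prop :=
  forall phi : {multiplicative G -> G}, bijective phi -> Rinfty_at phi.

(* Main.v *)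
(* The factors make G act on a tree, and the syllable length of a normal form is
   the distance between points of that tree on which G acts freely. For an
   automorphism t, let "spread t" be the largest displacement t gives to a
   finite generating set, and call t centred if no conjugate has smaller spread.
   Two facts hold uniformly in t. Bounded cancellation: if u lies on the
   geodesic from a to b, then t u lies within O(spread t) of the geodesic from
   t a to t b. And when t is centred, some word of length at most 2 in the
   generators is translated by t by at least spread t / 3. Hence a word X
   running through high powers of all these words satisfies
   l (t X) >= N * spread t for every centred t at once.

   Suppose X = f(w)^-1 c w, and let t_k be centred conjugates of f^-k. The
   recursion m_{k+1} = t_{k+1}(X)^-1 a_k m_k, with l (a_k) = O(spread t_{k+1}),
   moves a point so that l (m_k) is convex in k, and after a while grows by
   N * spread t_{k+1} at each step. Relative to t_k w the same point moves by
   t_{k+1}(c)^-1 instead of t_{k+1}(X)^-1, hence by O(spread t_{k+1}) with a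
   constant independent of N. If w does not lie on the side of X^-1, the second
   distance exceeds the first up to O(spread t_k), which is absurd; otherwise w
   does not lie on the side of f^-1(X), and f^-1 is used instead of f. So X can be
   chosen outside any finite number of twisted classes. *)
From HB Require Import structures.
Require Import Defs.
From mathcomp Require Import all_boot zify.
From mathcomp Require Import boolp classical_sets functions cardinality.

Set Implicit Arguments.
Unset Strict Implicit.
Unset Printing Implicit Defensive.

Local Open Scope group_scope.

(** * Tree lengths *)

Definition dist (G : groupType) (l : G -> nat) (x y : G) : nat := l ((x^-1 : G) * y).

(** [tl_four] is the four-point condition with one point at 1; [tl_geod] puts the integral points of
    geodesics in [G]. Branching may still occur at half-integers, hence the doubled Gromov products
    below. *)
Record tree_length (G : groupType) (l : G -> nat) : Prop := TreeLength {
  tl_eq1 : forall g : G, l g = 0%N <-> g = 1;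
  tl_inv : forall g : G, l g^-1 = l g;
  tl_four : forall f g h : G, (dist l f h + l g <=
    maxn (dist l f g + l h) (dist l g h + l f))%N;
  tl_geod : forall (g : G) r, (r <= l g)%N ->
    exists h : G, l h = r /\ dist l h g = (l g - r)%N }.

Section TreeMetric.
Variables (G : groupType) (l : G -> nat).
Hypothesis lT : tree_length l.

Local Notation d := (dist l).

(* Twice the Gromov product of x and y at o. *)
Definition gprod (o x y : G) : nat := (d o x + d o y - d x y)%N.

Lemma len1 : l 1 = 0%N. Proof. exact/(tl_eq1 lT). Qed.

Lemma dist1g g : d 1 g = l g. Proof. by rewrite /dist invg1 mul1g. Qed.

Lemma dist_sym x y : d x y = d y x.
Proof. by rewrite /dist -(tl_inv lT) invgM invgK. Qed.

Lemma distg1 g : d g 1 = l g. Proof. by rewrite dist_sym dist1g. Qed.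

Lemma distM g x y : d (g * x) (g * y) = d x y.
Proof. by rewrite /dist invgM mulgA mulgVK. Qed.

Lemma dist_mulr x y : d x (x * y) = l y.
Proof. by rewrite /dist mulKg. Qed.

Lemma distxx x : d x x = 0%N. Proof. by rewrite /dist mulVg len1. Qed.

Lemma dist_eq0 x y : d x y = 0%N -> x = y.
Proof.
by move=> /(tl_eq1 lT)/(congr1 (fun z => x * z)); rewrite mulVKg mulg1.
Qed.

Lemma dist_four x y z w :
  (d x y + d z w <= maxn (d x z + d y w) (d x w + d y z))%N.
Proof.
rewrite -(distM x^-1 x y) -(distM x^-1 x z) -(distM x^-1 x w).
rewrite -(distM x^-1 z w) -(distM x^-1 y w) -(distM x^-1 y z) mulVg !dist1g.
set Y := x^-1 * y; set Z := x^-1 * z; set W := x^-1 * w.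
have := tl_four lT Z Y W; rewrite (dist_sym Z Y).
by lia.
Qed.

Lemma dist_tri x y z : (d x z <= d x y + d y z)%N.
Proof. by have := dist_four x z y y; rewrite distxx (dist_sym z y); lia. Qed.

Lemma dist_tri3 x y z :
  [/\ (d x z <= d x y + d y z)%N, (d x y <= d x z + d y z)%N
    & (d y z <= d x y + d x z)%N].
Proof.
split; first exact: dist_tri.
- by rewrite (dist_sym y z) dist_tri.
- by rewrite (dist_sym x y) dist_tri.
Qed.

Lemma dist_quad x y z w :
  [/\ (d x y + d z w <= maxn (d x z + d y w) (d x w + d y z))%N,
      (d x z + d y w <= maxn (d x y + d z w) (d x w + d y z))%N
    & (d x w + d y z <= maxn (d x y + d z w) (d x z + d y w))%N].
Proof.
split; first exact: dist_four.
- by have := dist_four x z y w; rewrite (dist_sym z y).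
- by have := dist_four x w y z; rewrite (dist_sym w z) (dist_sym w y); lia.
Qed.

Lemma dist_geod x y r : (r <= d x y)%N ->
  exists h, d x h = r /\ (d x h + d h y)%N = d x y.
Proof.
move=> rd; have [h [hr hy]] := tl_geod lT rd; exists (x * h).
have -> : d x (x * h) = r by rewrite /dist mulKg.
split=> //; have -> : d (x * h) y = d h (x^-1 * y).
  by rewrite -(distM x h) mulVKg.
by rewrite hy subnKC.
Qed.

Lemma gprodM g o x y : gprod (g * o) (g * x) (g * y) = gprod o x y.
Proof. by rewrite /gprod !distM. Qed.

Lemma gprodC o x y : gprod o x y = gprod o y x.
Proof. by rewrite /gprod (dist_sym x y) addnC. Qed.

End TreeMetric.

(* Distances are rewritten to the order of the arguments, so that lia sees a
   single atom for each pair of points. *)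
Ltac dflip lT y x :=
  rewrite ?(dist_sym lT y x);
  repeat match goal with H : context [dist _ y x] |- _ =>
    rewrite (dist_sym lT y x) in H end.
Ltac tri lT x y z :=
  let H1 := fresh "T" in let H2 := fresh "T" in let H3 := fresh "T" in
  have [H1 H2 H3] := dist_tri3 lT x y z;
  dflip lT y x; dflip lT z x; dflip lT z y.
Ltac quad lT x y z w :=
  let H1 := fresh "Q" in let H2 := fresh "Q" in let H3 := fresh "Q" in
  have [H1 H2 H3] := dist_quad lT x y z w;
  tri lT x y z; tri lT x y w; tri lT x z w; tri lT y z w.

(** * Walks in the Cayley graph *)

(* Each strict coarsening makes one class representative superfluous. Only a bound
   linear in size E gives bounded cancellation linear in the spread. *)
Lemma stable_relation (T : eqType) (E : seq T) (R : nat -> T -> T -> Prop) :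
  (forall r x y, R r x y -> R r.+1 x y) ->
  (forall r x, x \in E -> R r x x) ->
  (forall r x y, R r x y -> R r y x) ->
  (forall r x y z, R r x y -> R r y z -> R r x z) ->
  exists r, (r <= size E)%N /\
    forall x y, x \in E -> y \in E -> R r.+1 x y -> R r x y.
Proof.
move=> Rm Rr Rs Rt; apply: contrapT => /forallNP unst.
have reps r : (r <= size E)%N -> exists L : seq T,
    [/\ {subset L <= E}, (size L + r <= size E)%N
      & forall x, x \in E -> exists2 y, y \in L & R r x y].
  elim: r => [_|r IH rE].
    by exists E; split=> // [|x xE]; [rewrite addn0 | exists x => //; apply: Rr].
  have [L [LE szL repL]] := IH (ltnW rE).
  have : ~ forall x y, x \in E -> y \in E -> R r.+1 x y -> R r x y.
    by move=> st; apply: (unst r); split=> //; apply: ltnW.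
  move=> /existsNP[x /existsNP[y /not_implyP[xE /not_implyP[yE
    /not_implyP[Rxy nRxy]]]]].
  have [a aL Rxa] := repL x xE; have [b bL Ryb] := repL y yE.
  have neq_ab : a != b.
    apply/eqP => eq_ab; apply: nRxy; apply: (Rt _ _ _ _ Rxa).
    by rewrite eq_ab; apply: Rs.
  exists (rem b L); split=> [z /mem_rem/LE //||z zE].
    rewrite size_rem //; case: L bL szL {LE repL aL} => //= *; lia.
  have [c cL Rzc] := repL z zE.
  have in_rem u : u \in L -> u != b -> u \in rem b L.
    move=> uL nub; have := perm_mem (perm_to_rem bL) u.
    by rewrite uL inE (negPf nub) /= => <-.
  have [eq_cb|neq_cb] := eqVneq c b; last first.
    by exists c; [apply: in_rem | apply: Rm].
  exists a; first exact: in_rem.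
  move: Rzc; rewrite eq_cb => Rzb; apply: (Rt _ _ _ _ (Rm _ _ _ Rzb)).
  apply: (Rt _ _ _ _ (Rs _ _ _ (Rm _ _ _ Ryb))).
  apply: (Rt _ _ _ _ (Rs _ _ _ Rxy)).
  exact: Rm.
have [L [LE szL repL]] := reps _ (leqnn _).
have {szL} L0 : L = [::] by apply/nilP; rewrite /nilp; lia.
apply: (unst (size E)); split=> // x y xE.
by have [z] := repL x xE; rewrite L0.
Qed.

Section Walks.
Variables (G : groupType) (S : seq G).
Hypothesis S_inv : forall s, s \in S -> s^-1 \in S.

Inductive conn (P : G -> Prop) (x : G) : G -> Prop :=
| Conn0 : P x -> conn P x x
| ConnS y s : conn P x y -> s \in S -> P (y * s) -> conn P x (y * s).

Lemma conn_r P x y : conn P x y -> P y.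
Proof. by case. Qed.

Lemma conn_mono (P Q : G -> Prop) x y :
  (forall v, P v -> Q v) -> conn P x y -> conn Q x y.
Proof.
move=> PQ; elim=> [Px|z s _ IH sS Pzs]; first exact/Conn0/PQ.
by apply: ConnS => //; apply: PQ.
Qed.

Lemma conn_trans P x y z : conn P x y -> conn P y z -> conn P x z.
Proof. by move=> xy; elim=> // u s _ IH sS Pus; apply: ConnS. Qed.

Lemma conn_sym P x y : conn P x y -> conn P y x.
Proof.
elim=> [Px|z s xz IH sS Pzs]; first exact: Conn0.
apply: (@conn_trans _ _ z) IH; have Pz := conn_r xz.
by have := ConnS (Conn0 Pzs) (S_inv sS); rewrite mulgK; apply.
Qed.

Lemma conn_left (P Q : G -> Prop) g x y :
  (forall v, P v -> Q (g * v)) -> conn P x y -> conn Q (g * x) (g * y).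
Proof.
move=> PQ; elim=> [Px|z s _ IH sS Pzs]; first exact/Conn0/PQ.
by rewrite mulgA; apply: ConnS; rewrite -?mulgA //; apply: PQ.
Qed.

(** Paths with their number of steps, so that excursions can be cut out by induction on what
    remains. *)
Fixpoint walk (P : G -> Prop) n x y : Prop :=
  if n is n'.+1 then P x /\ exists2 s, s \in S & walk P n' (x * s) y
  else P x /\ x = y.

Lemma walk_l P n x y : walk P n x y -> P x.
Proof. by case: n => [|n] []. Qed.

Lemma conn_walk P x y : conn P x y -> exists n, walk P n x y.
Proof.
move=> /conn_sym; elim=> [Px|z s _ [n IH] sS Pzs]; first by exists 0%N.
by exists n.+1; split=> //; exists s^-1; [apply: S_inv | rewrite mulgK].
Qed.

(** This is the last entry into [B]: the path stays in [B] after it. *)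
Lemma conn_entry (P B : G -> Prop) x y : conn P x y -> ~ B x -> B y ->
  exists z s, [/\ s \in S, ~ B z, B (z * s), conn P x (z * s)
    & conn (fun v => P v /\ B v) (z * s) y].
Proof.
move=> xy nBx; elim: xy => [//|z s xz IH sS Pzs Bzs].
have [Bz|nBz] := pselect (B z).
  have [u [s' [s'S nBu Bus xus uz]]] := IH Bz.
  by exists u, s'; split=> //; apply: ConnS.
exists z, s; split=> //; first exact: ConnS.
exact: Conn0.
Qed.

(** This is the first exit from [B]; the strictly shorter remainder feeds the induction in
    [lower_level]. *)
Lemma walk_exit (P B : G -> Prop) n x y : walk P n x y -> B x -> ~ B y ->
  exists z s m, [/\ s \in S, ~ B (z * s), (m < n)%N, walk P m (z * s) y
    & conn (fun v => P v /\ B v) x z].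
Proof.
move=> + + nBy; elim: n x => [|n IH] x /=; first by move=> [_ ->].
move=> [Px [s sS xsy]] Bx; have [Bxs|nBxs] := pselect (B (x * s)).
  have [z [s' [m [s'S nBz mn zy xz]]]] := IH _ xsy Bxs.
  exists z, s', m; split=> //; first exact: ltnW.
  apply: (@conn_trans _ _ (x * s)) => //.
  by apply: ConnS => //; [apply: Conn0 | split=> //; apply: walk_l xsy].
by exists x, s, n; split=> //; apply: Conn0.
Qed.

End Walks.

(** * Bounded cancellation *)

Record letter_gens (G : groupType) (l : G -> nat) (S : seq G) : Prop :=
  LetterGens {
    lg_inv : forall s, s \in S -> s^-1 \in S;
    lg_len : forall s, s \in S -> (l s <= 1)%N;
    lg_ind : forall P : G -> Prop, P 1 ->
      (forall g s, P g -> s \in S -> P (g * s)) -> forall g, P g }.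

Record automorphism (G : groupType) (t ti : G -> G) : Prop := Automorphism {
  autM : {morph t : x y / x * y};
  autK : cancel t ti;
  autVK : cancel ti t }.

Section Automorphism.
Variables (G : groupType) (t ti : G -> G).
Hypothesis tA : automorphism t ti.

Lemma aut1 : t 1 = 1.
Proof. by apply: (@mulgI _ (t 1)); rewrite -(autM tA) !mulg1. Qed.

Lemma autV x : t x^-1 = (t x)^-1.
Proof.
by apply: (@mulgI _ (t x)); rewrite -(autM tA) !mulgV aut1.
Qed.

Lemma aut_sym : automorphism ti t.
Proof.
split; [|exact: autVK tA|exact: autK tA] => x y.
by apply: (can_inj (autK tA)); rewrite (autM tA) !(autVK tA).
Qed.

Lemma autX x n : t (x ^+ n) = t x ^+ n.
Proof. by elim: n => [|n IH]; rewrite ?expg0 ?aut1 // !expgS (autM tA) IH. Qed.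

End Automorphism.

Section BoundedCancellation.
Variables (G : groupType) (l : G -> nat) (S : seq G) (t ti : G -> G).
Hypotheses (lT : tree_length l) (lS : letter_gens l S).
Hypothesis tA : automorphism t ti.

Local Notation d := (dist l).
Local Notation gp := (gprod l).
Local Notation conn := (conn S).

(** On a geodesic of a tree, a point is determined by its distance to one end. *)
Lemma interval_seq g : exists L : seq G, (size L <= (l g).+1)%N /\
  forall h, (d 1 h + d h g)%N = d 1 g -> h \in L.
Proof.
suff [L [szL HL]] : exists L : seq G, (size L <= (l g).+1)%N /\
    forall h, (l h < (l g).+1)%N -> (d 1 h + d h g)%N = d 1 g -> h \in L.
  exists L; split=> // h hg; apply: (HL) => //; move: hg.
  by rewrite (dist1g l h) (dist1g l g); lia.
have : ((l g).+1 <= (l g).+1)%N by [].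
elim: {1 3 4}(l g).+1 => [_|n IH ng]; first by exists [::].
have [L [szL HL]] := IH (ltnW ng).
have /(dist_geod lT)[h [hn hg]] : (n <= d 1 g)%N by rewrite dist1g; lia.
exists (h :: L); split=> [|k]; first by rewrite /= ltnS.
rewrite ltnS leq_eqVlt => /orP[/eqP[kn] kg|kn kg]; last by rewrite inE HL ?orbT.
rewrite inE; apply/orP; left; apply/eqP/(dist_eq0 lT).
by move: kn; rewrite -(dist1g l); quad lT (1 : G) g h k; lia.
Qed.

(** If 1 lies between [t g] and [t (g * s)], then [(t g)^-1] lies on the geodesic from 1 to [t s],
    which has at most [D.+1] points. *)
Lemma crossing_seq D : (forall s, s \in S -> (l (t s) <= D)%N) ->
  exists E : seq G, (size E <= size S * D.+1)%N /\
    forall g s, s \in S -> gp 1 (t g) (t (g * s)) = 0%N -> g \in E.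
Proof.
elim: S => [_|s S' IH sD]; first by exists [::].
have [|E [szE HE]] := IH; first by move=> u uS; apply: sD; rewrite inE uS orbT.
have [L [szL HL]] := interval_seq (t s).
exists ([seq ti x^-1 | x <- L] ++ E); split=> [|g u].
  by rewrite size_cat size_map mulSn leq_add // (leq_trans szL) // ltnS sD ?mem_head.
rewrite inE mem_cat => /orP[/eqP -> g1|uS g1]; last by rewrite (HE g u) ?orbT.
apply/orP; left; apply/mapP; exists (t g)^-1; last by rewrite invgK (autK tA).
apply: HL; rewrite -(distM l (t g) 1 (t g)^-1) -(distM l (t g) _ (t s)).
rewrite -(distM l (t g) 1 (t s)) mulgV mulg1 -(autM tA); move: g1.
by rewrite /gprod (dist_sym lT (t g) 1); tri lT (1 : G) (t g) (t (g * s)); lia.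
Qed.

Lemma conn_max (f : G -> nat) a b : exists B, conn (fun v => (f v <= B)%N) a b.
Proof.
suff /(_ (a^-1 * b)) : forall g, exists B, conn (fun v => (f v <= B)%N) a (a * g).
  by rewrite mulVKg.
apply: (lg_ind lS) => [|g s [B IH] sS].
  by exists (f a); rewrite mulg1; apply: Conn0.
exists (maxn B (f (a * g * s))); rewrite mulgA; apply: ConnS => //.
  by apply: conn_mono IH => v /leq_trans; apply; exact: leq_maxl.
exact: leq_maxr.
Qed.

Section Levels.
Variables (D : nat) (a b : G).
Hypothesis tD : forall s, s \in S -> (l (t s) <= D)%N.

Local Notation depth v := (gp (t v) (t a) (t b)).
Local Notation bcc := (2 * (D + size S * D.+1 + 1))%N.

(* A point h at distance i above a deepest vertex cuts off an excursion of the
   walk; the excursion enters and leaves at translates of points of E, which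
   are already connected inside the ball of radius i - 1 around h. *)
Lemma lower_level B : (bcc < B)%N ->
  conn (fun v => depth v <= B)%N a b -> conn (fun v => depth v <= B.-1)%N a b.
Proof.
move=> ltB; have [E [szE HE]] := crossing_seq tD.
pose E' := [seq g <- E | (l (t g) <= D)%N].
pose R r := conn (fun v => l (t v) <= D + r)%N.
have [r [ler stR]] : exists r, (r <= size E')%N /\
    forall x y, x \in E' -> y \in E' -> R r.+1 x y -> R r x y.
  apply: stable_relation => [r x y|r x|r x y|r x y z].
  - by apply: conn_mono => v; lia.
  - by rewrite mem_filter => /andP[? _]; apply: Conn0; lia.
  - exact: (conn_sym (lg_inv lS)).
  - exact: conn_trans.
have {ler} ler : (r <= size S * D.+1)%N.
  by apply: leq_trans ler (leq_trans _ szE); rewrite size_filter count_size.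
(* Inside the excursion a walk stays within [D + r.+1] of [h], and [stR] brings it within [D + r].
   Since [2 * i <= bcc < B], the point [h] stays off the geodesic from [t a] to [t b]. *)
pose i := (D + r).+1.
move=> ab; have [n abn] := conn_walk (lg_inv lS) ab.
(* Induction on the walk still to be lowered; the part from [a] to [x] is already low. *)
suff main m : forall n x, (n < m)%N ->
    walk S (fun v => depth v <= B)%N n x b ->
    conn (fun v => depth v <= B.-1)%N a x ->
    conn (fun v => depth v <= B.-1)%N a b.
  apply: (main n.+1 n a) => //; apply: Conn0.
  by rewrite /gprod (distxx lT); tri lT (t a) (t b) (t b); lia.
elim: m {n abn} => // m IH [|n] x; first by move=> _ [_ <-].
rewrite ltnS => ltnm [Bx].
move=> [s sS xsb] ax; set y := x * s in xsb.
have By := walk_l xsb.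
have [lty|gty] := leqP (depth y) B.-1.
  by apply: (IH _ _ ltnm xsb); apply: ConnS.
have {By gty} eqy : depth y = B by move: By gty; lia.
have [h [hi hya]] : exists h, d (t y) h = i /\
    (d (t y) h + d h (t a))%N = d (t y) (t a).
  apply: (dist_geod lT); move: eqy; rewrite /gprod /i.
  by tri lT (t y) (t a) (t b); lia.
(* [Q] describes the branch that [h] separates from [t a]. *)
pose Q v := gp h (t v) (t a) = 0%N.
have Qy : Q y.
  by rewrite /Q /gprod (dist_sym lT h (t y)); lia.
have nQa : ~ Q a.
  rewrite /Q /gprod (distxx lT); move: eqy; rewrite /gprod.
  by tri lT (t y) (t a) (t b); lia.
have gpab : (gp h (t a) (t b) + 2 * i = B)%N.
  move: eqy Qy; rewrite /Q /gprod.
  by quad lT (t y) h (t a) (t b); lia.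
have nQb : ~ Q b.
  move: gpab; rewrite /Q /gprod; dflip lT (t b) (t a); lia.
have dQ v : Q v -> depth v = (2 * d h (t v) + gp h (t a) (t b))%N.
  by move: gpab; rewrite /Q /gprod; quad lT (t v) h (t a) (t b); lia.
have tih z : t ((ti h)^-1 * z) = h^-1 * t z.
  by rewrite (autM tA) (autV tA) (autVK tA).
(* The image of an edge entering the branch passes over [h], so the edge becomes one of the finitely
   many crossings after translation. *)
have crossE e0 u : u \in S -> ~ Q e0 -> Q (e0 * u) ->
    (ti h)^-1 * (e0 * u) \in E' /\ (d h (t (e0 * u)) <= D)%N.
  move=> uS nQ0 Qu; set e := e0 * u in Qu *.
  have he : gp h (t e0) (t e) = 0%N.
    by move: nQ0 Qu; rewrite /Q /gprod; quad lT h (t e0) (t e) (t a); lia.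
  have de : (d h (t e) <= D)%N.
    apply: leq_trans (tD uS); rewrite -(dist1g l (t u)) -(distM l (t e0) 1) mulg1.
    rewrite -(autM tA) -/e; move: he; rewrite /gprod; lia.
  split=> //; rewrite mem_filter tih -[l _]/(d h (t e)) de.
  apply: (HE _ u^-1); first exact: (lg_inv lS).
  have -> : (ti h)^-1 * e * u^-1 = (ti h)^-1 * e0 by rewrite -mulgA mulgK.
  by rewrite !tih -(gprodM l h) mulg1 !mulVKg (gprodC lT).
have close e e' : conn (fun v => (depth v <= B)%N /\ Q v) e e' ->
    (ti h)^-1 * e \in E' -> (ti h)^-1 * e' \in E' ->
    conn (fun v => depth v <= B.-1)%N e e'.
  move=> ee' eE eE'.
  have: R r ((ti h)^-1 * e) ((ti h)^-1 * e').
    apply: stR => //; apply: conn_left ee' => v [Bv Qv].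
    rewrite tih -[l _]/(d h (t v)).
    by move: Bv; rewrite dQ //; lia.
  pose Y v := (depth v <= B.-1)%N.
  move=> /(@conn_left _ _ _ Y (ti h)); rewrite !mulVKg; apply => v lev.
  rewrite /Y.
  have {lev} lev : (d h (t (ti h * v)) <= D + r)%N.
    by rewrite -(distM l h^-1) mulVg (autM tA) (autVK tA) mulKg dist1g.
  by move: gpab lev; rewrite /gprod; tri lT (t (ti h * v)) h (t a);
    tri lT (t (ti h * v)) h (t b); tri lT (t (ti h * v)) (t a) (t b); lia.
have [e0 [u [uS nQ0 Qu au uy]]] : exists z s, [/\ s \in S, ~ Q z, Q (z * s),
    conn (fun v => depth v <= B.-1)%N a (z * s)
    & conn (fun v => (depth v <= B)%N /\ Q v) (z * s) y].
  (* Entering right at [y] would put [t y] within [D < i] of [h]; so the last entry is on the part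
     already lowered. *)
  have [Qx|nQx] := pselect (Q x); last first.
    have [_] := crossE _ _ sS nQx Qy; rewrite -/y.
    by move: hi; rewrite (dist_sym lT) /i; lia.
  have [z [u [uS nQz Qzu azu zux]]] := conn_entry ax nQa Qx.
  exists z, u; split=> //; apply: ConnS => //; last by rewrite -/y eqy.
  by apply: conn_mono zux => v [? ?]; split=> //; lia.
have [e [w [n' [wS nQe ltn' eb ye]]]] := walk_exit xsb Qy nQb.
have Qe := (conn_r ye).2.
have [uE _] := crossE _ _ uS nQ0 Qu.
have [eE _] : (ti h)^-1 * (e * w * w^-1) \in E' /\ (d h (t (e * w * w^-1)) <= D)%N.
  by apply: crossE; rewrite ?mulgK //; apply: (lg_inv lS).
rewrite mulgK in eE.
apply: (IH n'.+1 e).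
- by lia.
- by split; [case: (conn_r ye) | exists w].
- by apply: conn_trans au _; apply: close => //; apply: conn_trans uy ye.
Qed.

Lemma conn_bcc : conn (fun v => depth v <= bcc)%N a b.
Proof.
have [B] := conn_max (fun v => depth v) a b.
elim: B => [|B IH]; first by apply: conn_mono => v; lia.
have [leB|ltB] := leqP B.+1 bcc; first by apply: conn_mono => v; lia.
by move=> /(lower_level ltB).
Qed.

End Levels.

(** Letters have length at most 1, so a path from [a] to [b] cannot jump over a point [u] of the
    geodesic between them. *)
Lemma conn_cut (P : G -> Prop) u a b :
  conn P a b -> gp u a b = 0%N -> P u.
Proof.
elim=> [Pa|y s ay IH sS Pys].
  rewrite /gprod (distxx lT) => ua; rewrite (dist_eq0 lT (x := u) (y := a)) //; lia.
have [<- //|nuys] := eqVneq (y * s) u; have [<- _|nuy] := eqVneq y u.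
  exact: conn_r ay.
move=> u0; apply: IH.
have ds : (d y (y * s) <= 1)%N.
  by rewrite -(distM l y^-1) mulVg mulKg dist1g (lg_len lS).
have d1 : (0 < d u y)%N.
  by rewrite lt0n; apply/eqP => /(dist_eq0 lT) /esym; apply/eqP.
have d2 : (0 < d u (y * s))%N.
  by rewrite lt0n; apply/eqP => /(dist_eq0 lT) /esym; apply/eqP.
by move: u0 ds d1 d2; rewrite /gprod; quad lT u a y (y * s); lia.
Qed.

(** The low path given by [conn_bcc] has to pass through [u]. *)
Lemma bounded_cancellation D u a b :
  (forall s, s \in S -> (l (t s) <= D)%N) ->
  gp u a b = 0%N ->
  (gp (t u) (t a) (t b) <= 2 * (D + size S * D.+1 + 1))%N.
Proof. by move=> tD; apply: (conn_cut (conn_bcc a b tD)). Qed.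

End BoundedCancellation.

(** * Translations and base points *)

(** [z] is a buffer: the product [g * z * h] has no cancellation. *)
Definition branching (G : groupType) (l : G -> nat) : Prop :=
  forall g h : G, exists z : G,
    [/\ z <> 1, l (g * z)%g = (l g + l z)%N & l (z * h)%g = (l z + l h)%N].

Section Translation.
Variables (G : groupType) (l : G -> nat) (S : seq G).
Hypotheses (lT : tree_length l) (lS : letter_gens l S) (lB : branching l).

Local Notation d := (dist l).
Local Notation gp := (gprod l).

Lemma gprod_ultra o x y z : (minn (gp o x y) (gp o y z) <= gp o x z)%N.
Proof. by rewrite /gprod; quad lT o x y z; lia. Qed.

(** A positive product means leaving [o] in the same direction, so [z] can replace [x]. *)
Lemma gprod0_trans o x y z :
  gp o x y = 0%N -> (0 < gp o x z)%N -> gp o z y = 0%N.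
Proof. by move: (gprod_ultra o x z y); lia. Qed.

Lemma len_gt0 g : g <> 1 -> (0 < l g)%N.
Proof. by move=> g1; rewrite lt0n; apply/eqP => /(tl_eq1 lT). Qed.

Lemma exists_long n : exists g, (n <= l g)%N.
Proof.
elim: n => [|n [g ng]]; first by exists 1.
have [z [/len_gt0 z0 gz _]] := lB g 1.
by exists (g * z); rewrite gz; lia.
Qed.

(* Otherwise g would fix the midpoint of the geodesic from 1 to g. *)
Lemma len_even_sqr g n : l g = (2 * n)%N -> (0 < n)%N -> (l g < l (g * g)%g)%N.
Proof.
move=> gn n0; rewrite ltnNge; apply/negP => gg.
have /(dist_geod lT)[z [zn z1]] : (n <= d 1 g)%N by rewrite dist1g; lia.
have gV : (2 * n <= gp 1 g g^-1)%N.
  rewrite /gprod !dist1g (dist_sym lT) {1}/dist invgK (tl_inv lT). lia.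
have dg : d 1 g = (2 * n)%N by rewrite dist1g.
have V1 : gp 1 z g = (2 * n)%N by rewrite /gprod; lia.
have V2 : gp 1 g^-1 (g^-1 * z) = (2 * n)%N.
  rewrite -(gprodM l g) mulgV mulVKg mulg1 /gprod (dist_sym lT g 1).
  by rewrite (dist_sym lT g z); lia.
have dz : d 1 (g^-1 * z) = n.
  by rewrite -(distM l g) mulVKg mulg1 (dist_sym lT); lia.
have : gp 1 z (g^-1 * z) = (2 * n)%N.
  have := gprod_ultra 1 z g (g^-1 * z); have := gprod_ultra 1 g g^-1 (g^-1 * z).
  have : (gp 1 z (g^-1 * z) <= 2 * n)%N by rewrite /gprod zn dz; lia.
  by lia.
rewrite /gprod zn dz => dzz.
have /(dist_eq0 lT) : d z (g^-1 * z) = 0%N by lia.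
rewrite -{1}(mul1g z) => /mulIg/esym/eqP; rewrite invg_eq1 => /eqP g1.
by move: gn; rewrite g1 len1 //; lia.
Qed.

(** The four-point condition on 1, [g], [g ^+ n.+2], [g ^+ n.+3] carries the gain [tau] to the next
    power, provided lengths never drop below [l g]. *)
Lemma len_sqr_exp g tau n :
  (0 < tau)%N -> (l g + tau <= l (g * g)%g)%N -> (n * tau <= l (g ^+ n.+1))%N.
Proof.
move=> tau0 gtau.
suff : (n * tau <= l (g ^+ n.+1))%N /\
    (l (g ^+ n.+1) + tau <= l (g ^+ n.+2))%N /\ (l g <= l (g ^+ n.+1))%N.
  by case.
elim: n => [|n [IH1 [IH2 IH3]]]; first by rewrite expg1 expg2.
split; first by lia.
split; last by lia.
have e m : d 1 (g ^+ m) = l (g ^+ m) by rewrite dist1g.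
have e1 m : d g (g ^+ m.+1) = l (g ^+ m).
  by rewrite expgS -{1}(mulg1 g) distM dist1g.
have en : d (g ^+ n.+2) (g ^+ n.+3) = l g.
  by rewrite [X in d _ X]expgSr -{1}(mulg1 (g ^+ n.+2)) distM dist1g.
have [q1 q2 q3] := dist_quad lT 1 g (g ^+ n.+2) (g ^+ n.+3).
by move: q1 q2 q3; rewrite en !e !e1 dist1g; lia.
Qed.

Section Shift.
Variables (g P P' : G) (E : nat).
Hypotheses (gP : (d P (g * P)%g <= E)%N) (gP' : (d P' (g * P')%g <= E)%N).

(** These points are too far from both ends for [g] to push them off the segment from [P] to
    [P']. *)
Definition middle y := [/\ gp y P P' = 0%N, (E < d P y)%N & (E < d P' y)%N].

Lemma shift_middle y : middle y -> gp (g * y) P P' = 0%N.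
Proof.
move=> [y0 yP yP'].
have := distM l g P y; have := distM l g P' y; have := distM l g P P' => d1 d2 d3.
have : gp (g * y) P (g * P') = 0%N.
  apply: (@gprod0_trans _ (g * P)); first by rewrite gprodM.
  by move: d1 d2 d3 gP yP; rewrite /gprod; tri lT P (g * P) (g * y); lia.
rewrite (gprodC lT) => h; rewrite (gprodC lT).
apply: gprod0_trans h _.
by move: d1 d2 d3 gP' yP'; rewrite /gprod; tri lT P' (g * P') (g * y); lia.
Qed.

(** On middle points [g] acts as an orientation-preserving translation of the segment. *)
Lemma shift_dist y1 y2 : middle y1 -> middle y2 -> (d P y1 <= d P y2)%N ->
  d P (g * y2) = (d P (g * y1) + d y1 y2)%N.
Proof.
move=> m1 m2 le12; have [z1 p1 p1'] := m1; have [z2 p2 p2'] := m2.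
have : gp (g * y1) P (g * y2) = 0%N.
  apply: (@gprod0_trans _ (g * P)).
    rewrite gprodM; move: z1 z2 le12; rewrite /gprod.
    by quad lT P P' y1 y2; lia.
  have := distM l g P y1 => d1.
  by move: d1 gP p1; rewrite /gprod; tri lT P (g * P) (g * y1); lia.
by have := distM l g y1 y2; rewrite /gprod; tri lT P (g * y1) (g * y2); lia.
Qed.

End Shift.

(** Translations of a segment commute, so [g * h] and [h * g] agree on a middle point [z]; left
    multiplication being free, they are equal. *)
Lemma shift_commute g h P P' E :
  (d P (g * P)%g <= E)%N -> (d P' (g * P')%g <= E)%N ->
  (d P (h * P)%g <= E)%N -> (d P' (h * P')%g <= E)%N ->
  (4 * E + 4 < d P P')%N -> g * h = h * g.
Proof.
move=> gP gP' hP hP' far.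
(* The distance [2 * E + 2] leaves room for [z] to be moved by [E] and remain a middle point. *)
have /(dist_geod lT)[z [Pz zP']] : (2 * E + 2 <= d P P')%N by lia.
have mz : middle P P' E z.
  by split; move: Pz zP' far; rewrite /gprod; tri lT P P' z; lia.
have mid k : (d P (k * P)%g <= E)%N -> (d P' (k * P')%g <= E)%N ->
    middle P P' E (k * z).
  move=> kP kP'; have kz := shift_middle kP kP' mz; split=> //.
    have := distM l k P z => dk.
    by tri lT P (k * P) (k * z); lia.
  have := distM l k P' z => dk.
  by move: Pz zP' far; tri lT P' (k * P') (k * z); tri lT P P' z; lia.
have [mg mh] := (mid g gP gP', mid h hP hP').
have pos k k' : (d P (k * P)%g <= E)%N -> (d P' (k * P')%g <= E)%N ->
    middle P P' E (k' * z) ->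
    (d P (k * (k' * z))%g + d P z = d P (k * z)%g + d P (k' * z)%g)%N.
  move=> kP kP' mk; have [z0 _ _] := mz; have [z1 _ _] := mk.
  have [le1|/ltnW le1] := leqP (d P z) (d P (k' * z)).
    have := shift_dist kP kP' mz mk le1.
    by move: z0 z1; rewrite /gprod; quad lT P P' z (k' * z); lia.
  have := shift_dist kP kP' mk mz le1.
  by move: z0 z1; rewrite /gprod; quad lT P P' z (k' * z); lia.
have p1 := pos g h gP gP' mh; have p2 := pos h g hP hP' mg.
have m1 := shift_middle gP gP' mh; have m2 := shift_middle hP hP' mg.
have /(dist_eq0 lT) : d (g * (h * z)) (h * (g * z)) = 0%N.
  by move: m1 m2 p1 p2; rewrite /gprod; quad lT P P' (g * (h * z)) (h * (g * z)); lia.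
by rewrite !mulgA => /mulIg.
Qed.

(** In an abelian group 1, [z], [g^-1], [z * g^-1] would be a parallelogram whose diagonals are both
    [l z + l g], against the four-point condition. *)
Lemma noncommuting : exists s s', [/\ s \in S, s' \in S & s * s' <> s' * s].
Proof.
apply: contrapT => nex.
have SC s s' : s \in S -> s' \in S -> s * s' = s' * s.
  by move=> sS s'S; apply: contrapT => ne; apply: nex; exists s, s'.
have SG s g : s \in S -> s * g = g * s.
  move=> sS; move: g; apply: (lg_ind lS) => [|g s' IH s'S].
    by rewrite mulg1 mul1g.
  by rewrite mulgA IH -!mulgA (SC s s').
have GC (g h : G) : g * h = h * g.
  move: g; apply: (lg_ind lS) => [|g s IH sS]; first by rewrite mulg1 mul1g.
  by rewrite -mulgA (SG s h) // mulgA IH mulgA.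
have [g g1] := exists_long 1.
have [z [/len_gt0 z0 gz zg]] := lB g g^-1.
have gV := tl_inv lT g.
have e4 : d 1 (z * g^-1) = (l z + l g)%N by rewrite dist1g zg gV.
have e5 : d z (z * g^-1) = l g by rewrite dist_mulr gV.
have e6 : d g^-1 (z * g^-1) = l z by rewrite GC dist_mulr.
have e7 : d 1 g^-1 = l g by rewrite dist1g.
have e8 : d z g^-1 = (l g + l z)%N by rewrite (dist_sym lT) /dist invgK gz.
have e9 : d 1 z = l z by rewrite dist1g.
by move: e4 e5 e6 e7 e8 e9 z0 g1; quad lT (1 : G) z g^-1 (z * g^-1); lia.
Qed.

(* If P and P' were far apart, S would act by commuting translations on the
   middle of the geodesic between them. *)
Lemma base_unique t ti P P' E : automorphism t ti ->
  (forall s, s \in S -> (d P (t s * P)%g <= E)%N) ->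
  (forall s, s \in S -> (d P' (t s * P')%g <= E)%N) ->
  (d P P' <= 4 * E + 4)%N.
Proof.
move=> tA hP hP'; rewrite leqNgt; apply/negP => far.
have [s [s' [sS s'S]]] := noncommuting; apply.
apply: (can_inj (autK tA)); rewrite !(autM tA).
by apply: (shift_commute _ _ _ _ far); auto.
Qed.

End Translation.

(** * Centred automorphisms *)

Section Spread.
Variables (G : groupType) (l : G -> nat) (S : seq G).
Hypotheses (lT : tree_length l) (lS : letter_gens l S) (lB : branching l).

Local Notation d := (dist l).
Local Notation gp := (gprod l).

Definition spread (t : G -> G) := (\max_(s <- S) l (t s))%N.

(** Conjugating by [z] moves the base point from 1 to [z]: [l (z^-1 * t g * z)] is the displacement
    of [z] under [t g]. *)
Definition centered (t : G -> G) :=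
  forall z : G, (spread t <= spread (fun g => z^-1 * t g * z)%g)%N.

Lemma spread_ge t s : s \in S -> (l (t s) <= spread t)%N.
Proof. by move=> sS; rewrite /spread (big_rem s) //= leq_maxl. Qed.

Lemma spread_le t B :
  (forall s, s \in S -> (l (t s) <= B)%N) -> (spread t <= B)%N.
Proof. by move=> tB; rewrite /spread; apply/bigmax_leqP_seq => s /tB. Qed.

Lemma spread_attained t ti : automorphism t ti ->
  exists s, [/\ s \in S, s <> 1 & l (t s) = spread t].
Proof.
move=> tA.
have [s sS s1] : exists2 s, s \in S & s <> 1 :> G.
  apply: contrapT => nex; have [g] := exists_long lT lB 1.
  suff -> : g = 1 by rewrite len1.
  move: g; apply: (lg_ind lS) => // g s -> sS; rewrite mul1g.
  by apply: contrapT => s1; apply: nex; exists s.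
apply: contrapT => nex.
have lt0 : (0 < l (t s))%N.
  by apply: (len_gt0 lT) => e; apply: s1; rewrite -(autK tA s) e (aut1 (aut_sym tA)).
have sp0 := leq_trans lt0 (spread_ge t sS).
suff : (spread t <= (spread t).-1)%N by lia.
apply: spread_le => u uS; have := spread_ge t uS.
have [u1|u1] := eqVneq u 1; first by rewrite u1 (aut1 tA) len1.
suff : l (t u) <> spread t by lia.
by move=> e; apply: nex; exists u; split=> //; apply/eqP.
Qed.

Lemma spread_gt0 t ti : automorphism t ti -> (0 < spread t)%N.
Proof.
move=> tA; have [s [sS s1 <-]] := spread_attained tA.
by apply: (len_gt0 lT) => e; apply: s1; rewrite -(autK tA s) e (aut1 (aut_sym tA)).
Qed.

Definition short_word u := u \in S ++ [seq x * y | x <- S, y <- S].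

Lemma short_word1 s : s \in S -> short_word s.
Proof. by rewrite /short_word mem_cat => ->. Qed.

Lemma short_word2 s s' : s \in S -> s' \in S -> short_word (s * s').
Proof.
by move=> sS s'S; rewrite /short_word mem_cat (allpairs_f _ sS s'S) orbT.
Qed.

(** Along 1, [x], [x * y], [x * y * x], [x * y * x * y] each backtracking is too short to meet the
    next, so the losses simply add up. *)
Lemma len_mul_sqr (x y : G) T R :
  (gp 1 x^-1 y < R)%N -> (gp 1 y^-1 x < R)%N ->
  (R <= l x - T)%N -> (l x <= l y)%N ->
  (l (x * y)%g + T < l (x * y * (x * y))%g)%N.
Proof.
move=> a b RT xy.
have d01 : d 1 x = l x by rewrite dist1g.
have d12 : d x (x * y) = l y by rewrite dist_mulr.
have d23 : d (x * y) (x * y * x) = l x by rewrite dist_mulr.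
have d34 : d (x * y * x) (x * y * x * y) = l y by rewrite dist_mulr.
have g1 : gp x 1 (x * y) = gp 1 x^-1 y.
  by rewrite -(gprodM l x^-1) mulVg mulg1 mulKg.
have g2 : gp (x * y) x (x * y * x) = gp 1 y^-1 x.
  by rewrite -(gprodM l (x * y)^-1) mulVg mulKg invgM mulgVK.
have g3 : gp (x * y * x) (x * y) (x * y * x * y) = gp 1 x^-1 y.
  by rewrite -(gprodM l (x * y * x)^-1) mulVg mulKg invgM mulgVK.
have -> : x * y * (x * y) = x * y * x * y by rewrite mulgA.
rewrite -(dist1g l (x * y)) -(dist1g l (x * y * x * y)).
move: d01 d12 d23 d34 g1 g2 g3; rewrite /(gprod _ x) /(gprod _ (x * y))
  /(gprod _ (x * y * x)) => d01 d12 d23 d34 g1 g2 g3.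
have step : (d 1 (x * y * x) + gp 1 x^-1 y + gp 1 y^-1 x >= 2 * l x + l y)%N.
  by move: g1 g2 a b; quad lT (1 : G) x (x * y) (x * y * x); lia.
by move: g1 g3 a b step; quad lT (1 : G) (x * y) (x * y * x) (x * y * x * y);
  tri lT (1 : G) x (x * y); lia.
Qed.

(* Otherwise the base point could be moved one step towards t s0, where s0 attains
   the spread, and the spread would decrease. *)
Lemma translating_word_big t ti : automorphism t ti -> centered t ->
  (2 <= spread t)%N ->
  exists u, short_word u /\
    (l (t u) + (spread t - 2)./2 < l (t u * t u)%g)%N.
Proof.
move=> tA tC D2; set D := spread t in D2 *; pose T := (D - 2)./2.
apply: contrapT => nex.
have {nex} noT u : short_word u -> (l (t u * t u)%g <= l (t u) + T)%N.
  by move=> uU; rewrite leqNgt; apply/negP => ltu; apply: nex; exists u.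
have [s0 [s0S _ s0D]] := spread_attained tA.
have /(dist_geod lT)[z [z1 zs0]] : (1 <= d 1 (t s0))%N by rewrite dist1g s0D; lia.
suff : (spread (fun g => (z^-1 * t g * z)%g) <= D.-1)%N by have := tC z; lia.
apply: spread_le => s sS; set g := t s; set g0 := t s0 in s0D zs0.
have gD : (l g <= D)%N by apply: spread_ge.
have -> : l (z^-1 * g * z) = d z (g * z) by rewrite /dist mulgA.
have [g1|/len_gt0 g1] := pselect (g = 1); first by rewrite g1 mul1g (distxx lT); lia.
have {}g1 := g1 _ lT.
(* Without translation, [g] and [g^-1] share an initial segment of length at least
   [(l g - T) / 2]. *)
have gVV : (l g - T <= gp 1 g g^-1)%N.
  rewrite /gprod !dist1g (dist_sym lT) /dist invgK (tl_inv lT).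
  by have := noT s (short_word1 sS); rewrite -/g; lia.
have g0VV : (D - T <= gp 1 g0 g0^-1)%N.
  rewrite /gprod !dist1g (dist_sym lT) /dist invgK (tl_inv lT).
  by have := noT s0 (short_word1 s0S); rewrite -/g0; lia.
have zg0 : gp 1 z g0 = 2%N by rewrite /gprod; lia.
(* The doubled length known to be shared by [g] and [g^-1], capped at 2, the doubled distance from 1
   to [z]. *)
pose R := minn 2 (l g - T).
(* Little cancellation at both joints would make [s * s0] a translating word. *)
have small : ~ ((gp 1 g^-1 g0 < R) && (gp 1 g0^-1 g < R))%N.
  move=> /andP[lt1 lt2].
  have := @len_mul_sqr g g0 T R lt1 lt2 (geq_minr _ _).
  have := noT _ (short_word2 sS s0S); rewrite (autM tA) -/g -/g0 s0D.
  by move=> h1 /(_ gD); lia.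
have lt_tr x y w : (gp 1 x w < R -> R <= gp 1 x y -> gp 1 y w < R)%N.
  by have := gprod_ultra lT 1 x y w; lia.
have R2 : (R <= gp 1 z g0)%N by rewrite zg0 geq_minl.
have RV : (R <= gp 1 g^-1 g)%N by rewrite (gprodC lT); move: gVV; rewrite /R; lia.
have R0V : (R <= gp 1 g0 g0^-1)%N by move: g0VV; rewrite /R /T; lia.
have Rz : (R <= gp 1 z g)%N.
  rewrite leqNgt; apply/negP => ltR; apply: small.
  have lt1 := lt_tr _ _ _ ltR R2; have lt2 := lt_tr _ _ _ lt1 R0V.
  rewrite lt2 andbT ltnNge; apply/negP => le3.
  by have := gprod_ultra lT 1 g0 g^-1 g; rewrite (gprodC lT 1 g0 g^-1); lia.
have RzV : (R <= gp 1 z g^-1)%N.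
  rewrite leqNgt; apply/negP => ltR; apply: small.
  have lt1 := lt_tr _ _ _ ltR R2; rewrite (gprodC lT 1 g^-1) lt1 /=.
  rewrite ltnNge; apply/negP => le3.
  have := gprod_ultra lT 1 g0 g0^-1 g; have := gprod_ultra lT 1 g0 g g^-1.
  by rewrite (gprodC lT 1 g g^-1); lia.
have e1 : d (g * z) g = 1%N by rewrite (dist_sym lT) dist_mulr -(dist1g l).
have e2 : d (g * z) 1 = d z g^-1.
  by rewrite (dist_sym lT) -(distM l g z g^-1) mulgV (dist_sym lT).
have e3 : d 1 g^-1 = d 1 g by rewrite !dist1g (tl_inv lT).
have e4 : d 1 g = l g by rewrite dist1g.
have [q _ _] := dist_quad lT z (g * z) 1 g.
have := dist_tri lT z 1 g; have := dist_tri lT z 1 g^-1.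
move: q Rz RzV; rewrite e1 e2 (dist_sym lT z 1) /gprod e3 e4 z1 /R /T.
by clear -D2 gD g1; lia.
Qed.

Lemma translating_word_one t ti : automorphism t ti -> spread t = 1%N ->
  exists u, short_word u /\ (l (t u) < l (t u * t u)%g)%N.
Proof.
move=> tA D1; apply: contrapT => nex.
have {nex} no u : short_word u -> (l (t u * t u)%g <= l (t u))%N.
  by move=> uU; rewrite leqNgt; apply/negP => ltu; apply: nex; exists u.
have le1 s : s \in S -> (l (t s) <= 1)%N by move=> /(spread_ge t); rewrite D1.
have le11 s s' : s \in S -> s' \in S -> (d (t s) (t s') <= 1)%N.
  move=> sS s'S; have [w wU ew] : exists2 w, short_word w & d (t s) (t s') = l (t w).
    exists (s^-1 * s'); first exact: short_word2 (lg_inv lS sS) s'S.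
    by rewrite (autM tA) (autV tA).
  have le2 : (d (t s) (t s') <= 2)%N.
    apply: leq_trans (dist_tri lT _ 1 _) _; rewrite dist1g distg1 //.
    by have := le1 _ sS; have := le1 _ s'S; lia.
  rewrite leqNgt; apply/negP => lt2.
  have e2 : l (t w) = (2 * 1)%N by lia.
  by have := len_even_sqr lT e2 isT; have := no _ wU; lia.
have [s1 [s1S _ s1D]] := spread_attained tA; rewrite D1 in s1D.
(* [Q] is the stabiliser of the branch point halfway from 1 to [t s1]. It contains every [t s],
   hence all of [t G = G], which is unbounded. *)
pose Q g := (l g = 0 \/ [/\ l g = 1, 0 < gp 1 g (t s1) & 0 < gp 1 g^-1 (t s1)])%N.
have QS s : s \in S -> Q (t s).
  move=> sS; have := le1 s sS; case e: (l (t s)) => [|[|//]] _; [by left|right].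
  split=> //; first by rewrite /gprod !dist1g e s1D; have := le11 _ _ sS s1S; lia.
  have := le11 _ _ (lg_inv lS sS) s1S.
  by rewrite /gprod !dist1g (autV tA) (tl_inv lT) e s1D; lia.
have Qt g : Q (t g).
  move: g; apply: (lg_ind lS) => [|g s Qg sS]; first by left; rewrite (aut1 tA) len1.
  rewrite (autM tA); move: Qg (QS s sS); set x := t g; set y := t s.
  case=> [/(tl_eq1 lT)->|[x1 x2 x3]]; first by rewrite mul1g.
  case=> [/(tl_eq1 lT)->|[y1 y2 y3]]; first by rewrite mulg1; right.
  have xy : (l (x * y)%g <= 1)%N.
    have := gprod_ultra lT 1 x^-1 (t s1) y; rewrite (gprodC lT 1 (t s1)).
    by rewrite {3}/gprod !dist1g {1}/dist invgK (tl_inv lT); lia.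
  case e: (l (x * y)%g) xy => [|[|//]] _; [by left|right; split=> //].
    have := gprod_ultra lT 1 (x * y) x (t s1).
    have : gp 1 (x * y) x = 1%N.
      by rewrite /gprod !dist1g (dist_sym lT) dist_mulr; lia.
    by lia.
  have := gprod_ultra lT 1 (x * y)^-1 y^-1 (t s1).
  have : gp 1 (x * y)^-1 y^-1 = 1%N.
    rewrite /gprod !dist1g !(tl_inv lT) (dist_sym lT) invgM dist_mulr (tl_inv lT).
    by lia.
  by lia.
have [g g2] := exists_long lT lB 2.
by have := Qt (ti g); rewrite (autVK tA) => -[|[]]; lia.
Qed.

Lemma translating_word t ti : automorphism t ti -> centered t ->
  exists u, short_word u /\
    forall n, (n * spread t <= 3 * l (t u ^+ n.+1)%g)%N.
Proof.
move=> tA tC; have D0 := spread_gt0 tA.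
have [u [tau [uU tau0 letau ltu]]] : exists u tau, [/\ short_word u, (0 < tau)%N,
    (spread t <= 3 * tau)%N & (l (t u) + tau <= l (t u * t u)%g)%N].
  have [D2|D1] := leqP 2 (spread t).
    have [u [uU ltu]] := translating_word_big tA tC D2.
    by exists u, ((spread t - 2)./2).+1; split=> //; lia.
  have {}D1 : spread t = 1%N by lia.
  have [u [uU ltu]] := translating_word_one tA D1.
  by exists u, 1%N; split=> //; lia.
exists u; split=> // n; have := len_sqr_exp lT n tau0 ltu.
have : (n * spread t <= n * (3 * tau))%N by rewrite leq_mul2l letau orbT.
by lia.
Qed.

End Spread.

(** * Generic words *)

Section Generic.
Variables (G : groupType) (l : G -> nat) (S : seq G).
Hypotheses (lT : tree_length l) (lS : letter_gens l S) (lB : branching l).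

Local Notation d := (dist l).
Local Notation gp := (gprod l).
Local Notation spread := (spread l S).
Local Notation centered := (centered l S).

(** As the spread [D] is positive, [2 * (D + size S * D.+1 + 1) <= bcc * D]. *)
Definition bcc := (4 * size S + 4)%N.

Lemma gprod_aut t ti u a b : automorphism t ti -> gp u a b = 0%N ->
  (gp (t u) (t a) (t b) <= bcc * spread t)%N.
Proof.
move=> tA uab; have := spread_gt0 lT lS lB tA.
have := bounded_cancellation lT lS tA (fun s sS => spread_ge l t sS) uab.
by rewrite /bcc; nia.
Qed.

Lemma len_tri x y : (l (x * y)%g <= l x + l y)%N.
Proof.
by rewrite -(dist1g l) -(dist1g l x) -(dist_mulr l x y) dist_tri.
Qed.

(** The constant [n] has to serve all automorphisms at once. *)
Definition aut_bound n g := forall t ti, automorphism t ti ->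
  (l (t g) <= n * spread t)%N.

Lemma aut_bound_ex g : exists n, aut_bound n g.
Proof.
move: g; apply: (lg_ind lS) => [|g s [n gn] sS].
  by exists 0%N => t ti tA; rewrite (aut1 tA) len1.
exists n.+1 => t ti tA; rewrite (autM tA).
have := len_tri (t g) (t s); have := gn t ti tA.
by have := spread_ge l t sS; lia.
Qed.

Lemma aut_bound_seq (L : seq G) : exists n, forall g, g \in L -> aut_bound n g.
Proof.
elim: L => [|g L [n IH]]; first by exists 0%N.
have [m gm] := aut_bound_ex g; exists (maxn n m) => h.
rewrite inE => /orP[/eqP -> |hL] t ti tA.
  by apply: leq_trans (gm t ti tA) _; rewrite leq_mul2r leq_maxr orbT.
by apply: leq_trans (IH h hL t ti tA) _; rewrite leq_mul2r leq_maxl orbT.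
Qed.

Lemma automorphism_conj (t ti : G -> G) (z : G) : automorphism t ti ->
  automorphism (fun g => z^-1 * t g * z) (fun g => ti (z * g * z^-1)).
Proof.
move=> tA; split=> [x y|x|x].
- by rewrite (autM tA) !mulgA mulgK.
- by rewrite !mulgA mulgV mul1g mulgK (autK tA).
- by rewrite (autVK tA) !mulgA mulVg mul1g mulgVK.
Qed.

Lemma automorphism_comp (t ti f fi : G -> G) : automorphism t ti -> automorphism f fi ->
  automorphism (t \o f) (fi \o ti).
Proof.
move=> tA fA; split=> [x y|x|x] /=.
- by rewrite (autM fA) (autM tA).
- by rewrite (autK tA) (autK fA).
- by rewrite (autVK fA) (autVK tA).
Qed.

Lemma center_ex (t : G -> G) : exists z : G, centered (fun g => z^-1 * t g * z).
Proof.
pose P n := `[< exists z : G, spread (fun g => z^-1 * t g * z)%g = n >].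
have exP : exists n, P n.
  by exists (spread (fun g => 1^-1 * t g * 1)%g); apply/asboolP; exists 1.
have [n /asboolP[z <-] minz] := ex_minnP exP; exists z => y.
apply: minz; apply/asboolP; exists (z * y); congr spread.
by apply: funext => g; rewrite invgM !mulgA.
Qed.

Lemma branching_len g h z : z <> 1 -> l (g * z)%g = (l g + l z)%N ->
  l (z * h)%g = (l z + l h)%N ->
  gp g 1 (g * z * h) = 0%N /\ gp (g * z) 1 (g * z * h) = 0%N.
Proof.
move=> /(len_gt0 lT) z0 gz zh.
have e1 : d 1 g = l g by rewrite dist1g.
have e2 : d 1 (g * z) = (l g + l z)%N by rewrite dist1g.
have e3 : d g (g * z) = l z by rewrite dist_mulr.
have e4 : d (g * z) (g * z * h) = l h by rewrite dist_mulr.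
have e5 : d g (g * z * h) = (l z + l h)%N by rewrite -mulgA dist_mulr.
by split; move: z0; rewrite /gprod; quad lT (1 : G) g (g * z) (g * z * h); lia.
Qed.

Lemma cut_extend y x x' :
  gp y 1 x = 0%N -> gp x 1 x' = 0%N -> gp y 1 x' = 0%N.
Proof.
rewrite /gprod; tri lT (1 : G) y x; tri lT (1 : G) x x'; tri lT y x x'.
by tri lT (1 : G) y x'; lia.
Qed.

(** Each word of [L] is appended after a buffer from [lB], so nothing cancels and earlier points
    stay on the geodesic. *)
Lemma word_through (L : seq G) alpha : exists X,
  gp alpha 1 X = 0%N /\
  forall u, u \in L -> exists y, gp y 1 X = 0%N /\ gp (y * u) 1 X = 0%N.
Proof.
elim: L => [|u L [X [aX LX]]].
  by exists alpha; split=> //; rewrite /gprod (distxx lT) (dist_sym lT); lia.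
have [z [z1 Xz zu]] := lB X u; have [c1 c2] := branching_len z1 Xz zu.
exists (X * z * u); split=> [|v]; first exact: cut_extend aX c1.
rewrite inE => /orP[/eqP ->|/LX[y [y1 y2]]].
  exists (X * z); split=> //.
  by rewrite /gprod (distxx lT) (dist_sym lT 1); lia.
by exists y; split; [exact: cut_extend y1 c1|exact: cut_extend y2 c1].
Qed.

Definition generic N X := forall t ti, automorphism t ti -> centered t ->
  (N * spread t <= l (t X))%N.

Lemma generic_ex f fi N : automorphism f fi ->
  exists X, generic N X /\ gp 1 X^-1 (fi X) = 0%N.
Proof.
move=> fA; have fiA := aut_sym fA.
(* A third of [M] pays for [N] and for the [bcc] lost at the ends of the power [u ^+ M.+1]. *)
pose M := (3 * (N + bcc))%N.
pose L := [seq u ^+ M.+1 | u <- S ++ [seq x * y | x <- S, y <- S]].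
have [g gL] := exists_long lT lB (bcc * spread fi).+1.
have [Y [aY LY]] := word_through L (f g).
have [z [z1 Yz zg]] := lB Y g.
have YX : gp Y 1 (Y * z) = 0%N.
  by rewrite /gprod (dist_sym lT) !dist1g dist_mulr Yz; lia.
exists (Y * z); split=> [t ti tA tC|].
  have [u [uU lu]] := translating_word lT lS lB tA tC.
  have [y [y1 y2]] : exists y, gp y 1 Y = 0%N /\ gp (y * u ^+ M.+1) 1 Y = 0%N.
    by apply: LY; apply/mapP; exists u.
  have := gprod_aut tA (cut_extend y1 YX); have := gprod_aut tA (cut_extend y2 YX).
  have := lu M; rewrite -(autX tA) -(dist_mulr l (t y)) -(autM tA) (aut1 tA).
  rewrite -(dist1g l (t (Y * z))).
  set P := t y; set P' := t (y * _); set Q := t (Y * z).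
  by rewrite /gprod /M; quad lT (1 : G) P P' Q; nia.
(* [X^-1] starts along [z^-1]. [X] passes through [f g], so [fi X] starts along [g], which is too
   long to be cancelled; and [z * g] has no cancellation. *)
apply: (@gprod0_trans _ _ lT _ z^-1); last first.
  rewrite /gprod !dist1g !(tl_inv lT) invgM dist_mulr (tl_inv lT) Yz.
  by have := len_gt0 lT z1; lia.
rewrite (gprodC lT); apply: (@gprod0_trans _ _ lT _ g).
  by rewrite /gprod !dist1g (tl_inv lT) (dist_sym lT) /dist invgK zg; lia.
have := gprod_aut fiA (cut_extend aY YX); rewrite (aut1 fiA) (autK fA).
by move: gL; rewrite -(dist1g l g) /gprod; tri lT (1 : G) g (fi (Y * z)); lia.
Qed.

End Generic.

(** * Twisted conjugates of a generic word *)

Section Renormalization.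
Variables (G : groupType) (l : G -> nat) (S : seq G).
Hypotheses (lT : tree_length l) (lS : letter_gens l S) (lB : branching l).
Variables (f fi : G -> G) (L : nat).
Hypothesis fA : automorphism f fi.
Hypothesis L_gt0 : (0 < L)%N.
Hypothesis fL : forall s, s \in S -> aut_bound l S L (f s).
Hypothesis fiL : forall s, s \in S -> aut_bound l S L (fi s).

Local Notation d := (dist l).
Local Notation gp := (gprod l).
Local Notation spread := (spread l S).
Local Notation centered := (centered l S).
Local Notation kappa := (bcc S).

Definition drift := (8 * (L * L))%N.

(** Both 1 and [a] are moved by at most [L * L * spread t'] under [t' s], so [base_unique] bounds
    [a]. *)
Lemma recenter t ti t' ti' a :
  automorphism t ti -> automorphism t' ti' -> centered t -> centered t' ->
  (forall g, t' (f g) = a * t g * a^-1) ->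
  [/\ (spread t' <= L * spread t)%N, (spread t <= L * spread t')%N
    & (l a <= drift * spread t')%N].
Proof.
move=> tA tA' tC tC' tt'.
have tfi g : t (fi g) = a^-1 * t' g * a.
  by rewrite -{2}(autVK fA g) tt' !mulgA mulVg mul1g mulgVK.
have le1 : (spread t' <= L * spread t)%N.
  apply: leq_trans (tC' a) _; apply: spread_le => s sS; rewrite -tfi.
  exact: (fiL sS tA).
have le2 : (spread t <= L * spread t')%N.
  apply: leq_trans (tC a^-1) _; apply: spread_le => s sS.
  by rewrite invgK -tt'; apply: (fL sS tA').
split=> //.
have sp0 := spread_gt0 lT lS lB tA'.
have : (d 1 a <= 4 * (L * L * spread t') + 4)%N.
  apply: (base_unique lT lS lB tA') => s sS.
    rewrite mulg1 dist1g; apply: leq_trans (spread_ge l t' sS) _.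
    by rewrite leq_pmull // muln_gt0 L_gt0.
  have -> : d a (t' s * a) = l (t (fi s)) by rewrite tfi /dist mulgA.
  by apply: leq_trans (fiL sS tA) _; rewrite -mulnA leq_mul2l le2 orbT.
rewrite dist1g /drift => /leq_trans; apply.
have : (0 < L * L * spread t')%N by rewrite !muln_gt0 L_gt0.
by lia.
Qed.

(* t k is a conjugate of f^-k. *)
Lemma centered_seq : exists (t ti : nat -> G -> G) (a : nat -> G), forall k,
  [/\ automorphism (t k) (ti k), centered (t k)
    & forall g, t k.+1 (f g) = a k * t k g * (a k)^-1].
Proof.
have iA k : automorphism (iter k fi) (iter k f).
  elim: k => [|k IH]; first by split.
  have := automorphism_comp IH (aut_sym fA).
  by congr automorphism; apply: funext => g; rewrite ?iterSr.
have /choice[r rC] : forall k, exists z,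
    centered (fun g => z^-1 * iter k fi g * z).
  by move=> k; apply: center_ex.
exists (fun k g => (r k)^-1 * iter k fi g * r k),
  (fun k g => iter k f (r k * g * (r k)^-1)), (fun k => (r k.+1)^-1 * r k).
move=> k; split; [exact: automorphism_conj | exact: rC | move=> g].
by rewrite iterSr (autK fA) invgM invgK !mulgA !mulgK.
Qed.

(** Large enough to leave [n + drift + kappa + 1] after the errors in either alternative of [conv]
    below. *)
Definition stretch n := (n + 4 * drift + 2 * kappa + kappa * L + 1)%N.

Section Orbit.
Variables (X w c : G) (n : nat).
Hypothesis c_n : aut_bound l S n c.
Hypothesis X_gen : generic l S (stretch n) X.
Hypothesis X_cut : gp 1 X^-1 (fi X) = 0%N.
Hypothesis w_cut : gp 1 w X^-1 = 0%N.
Hypothesis wXc : X^-1 * f w = w * c^-1.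

Lemma orbit_absurd : False.
Proof.
have [t [ti [a H]]] := centered_seq.
have tA k : automorphism (t k) (ti k) by case: (H k).
have tC k : centered (t k) by case: (H k).
have ta k g : t k.+1 (f g) = a k * t k g * (a k)^-1 by case: (H k).
have rec k := recenter (tA k) (tA k.+1) (tC k) (tC k.+1) (ta k).
pose m := fix m k := if k is k'.+1 then (t k X)^-1 * (a k' * m k') else 1.
have mS k : m k.+1 = (t k.+1 X)^-1 * (a k * m k) by [].
pose p k := (t k w)^-1 * m k.
pose D k := spread (t k); pose u k := l (m k); pose v k := l (p k).
have D0 k : (0 < D k)%N := spread_gt0 lT lS lB (tA k).
have DL k : (D k <= L * D k.+1)%N by case: (rec k).
have ak k : (l (a k) <= drift * D k.+1)%N by case: (rec k).
have lV g := tl_inv lT g.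
(* The equation [f w = X * w * c^-1] turns the recursion of [m] into the same one with [c] in place
   of [X]. *)
have pS k : p k.+1 = (t k.+1 c)^-1 * (a k * p k).
  have aw : a k * t k w = t k.+1 (f w) * a k by rewrite ta mulgVK.
  have -> : p k.+1 = (t k.+1 w)^-1 * (t k.+1 X)^-1 * (a k * t k w) * p k.
    by rewrite /p mS !mulgA mulgK.
  have <- : (t k.+1 w)^-1 * (t k.+1 X)^-1 * t k.+1 (f w) = (t k.+1 c)^-1.
    by rewrite -!(autV (tA _)) -!(autM (tA _)) -mulgA wXc mulKg.
  by rewrite aw !mulgA.
have vS k : (v k.+1 <= v k + (n + drift) * D k.+1)%N.
  rewrite /v pS; apply: leq_trans (len_tri lT _ _) _.
  apply: leq_trans (leq_add (leqnn _) (len_tri lT _ _)) _.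
  by have := ak k; have := c_n (tA k.+1); rewrite lV mulnDl -/(D _); lia.
have XD k : (stretch n * D k <= l (t k X))%N := X_gen (tA k) (tC k).
have A1 k : (d (t k.+1 X^-1) (m k.+1) <= u k + l (a k))%N.
  rewrite (autV (tA _)) mS -{1}(mulg1 (t k.+1 X)^-1) distM dist1g addnC.
  exact: len_tri.
have B1 k : (d (t k (fi X)) (m k) <= u k.+1 + l (a k))%N.
  have -> : d (t k (fi X)) (m k) = l ((a k)^-1 * m k.+1).
    have -> : t k (fi X) = (a k)^-1 * t k.+1 X * a k.
      by rewrite -{2}(autVK fA X) ta !mulgA mulVg mul1g mulgVK.
    by rewrite /dist mS !invgM invgK !mulgA.
  by rewrite -(lV (a k)) addnC; apply: len_tri.
have B2 k : (l (t k.+1 X) <= l (t k (fi X)) + 2 * l (a k))%N.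
  have := ta k (fi X); rewrite (autVK fA) => ->.
  have := len_tri lT (a k * t k (fi X)) (a k)^-1; have := len_tri lT (a k) (t k (fi X)).
  by rewrite lV; lia.
have cut k : (gp 1 (t k X^-1) (t k (fi X)) <= kappa * D k)%N.
  by have := gprod_aut lT lS lB (tA k) X_cut; rewrite (aut1 (tA k)).
have wcut k : (gp 1 (t k w) (t k X^-1) <= kappa * D k)%N.
  by have := gprod_aut lT lS lB (tA k) w_cut; rewrite (aut1 (tA k)).
pose N := (n + drift + kappa + 1)%N.
(* Seen from 1, [m k.+1] cannot go far along both [t k.+1 X^-1] and [t k.+1 (fi X)]; the one it
   avoids forces growth, backward in [k] or forward. *)
have conv k : (u k.+1 + N * D k.+1 <= u k)%N \/
    (u k.+1 + N * D k.+2 <= u k.+2)%N.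
  have := gprod_ultra lT 1 (t k.+1 X^-1) (m k.+1) (t k.+1 (fi X)).
  have := cut k.+1; have := A1 k; have := B1 k.+1; have := B2 k.+1.
  have := ak k; have := ak k.+1; have := XD k.+1; have := XD k.+2.
  have : (kappa * D k.+1 <= kappa * L * D k.+2)%N.
    by rewrite -mulnA leq_mul2l DL orbT.
  rewrite /gprod !dist1g (autV (tA _)) lV -/(u k.+1) /stretch /N !mulnDl.
  by rewrite (dist_sym lT (m k.+1)) !mul1n; lia.
(* Decrease cannot last for ever, and one growing step excludes the decreasing alternative from then
   on. *)
have [k0 grow0] : exists k, (u k.+1 + N * D k.+2 <= u k.+2)%N.
  apply: contrapT => nex.
  have dec k : (u k + k <= u 0)%N.
    elim: k => [|k IH]; first by rewrite addn0.
    have [le1|le1] := conv k; last by case: nex; exists k.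
    have : (0 < N * D k.+1)%N by rewrite muln_gt0 D0 /N addn1.
    by lia.
  by have := dec (u 0).+1; lia.
have grow j : (u (k0 + j).+1 + N * D (k0 + j).+2 <= u (k0 + j).+2)%N.
  elim: j => [|j IH]; first by rewrite addn0.
  rewrite addnS; have [le1|//] := conv (k0 + j).+1.
  have : (0 < N * D (k0 + j).+2)%N by rewrite muln_gt0 D0 /N addn1.
  by lia.
(* Once [u] grows, [m] goes along [t X^-1], while [t w] does not, so the path from [t w] to [m]
   nearly passes through 1. *)
have close j : (u (k0 + j).+2 <= v (k0 + j).+2 + kappa * D (k0 + j).+2)%N.
  have := A1 (k0 + j).+1; have := grow j; have := ak (k0 + j).+1.
  have := XD (k0 + j).+2; have := wcut (k0 + j).+2; have := D0 (k0 + j).+2.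
  set k := (k0 + j).+2; have := gprod_ultra lT 1 (t k w) (m k) (t k X^-1).
  have -> : v k = d (t k w) (m k) by [].
  rewrite /gprod !dist1g (autV (tA _)) lV -/(u k) /stretch /N !mulnDl.
  by rewrite (dist_sym lT (m k)) mul1n; lia.
have gain j : (u (k0 + j).+1 + v k0.+1 >= v (k0 + j).+1 + u k0.+1 + j)%N.
  elim: j => [|j IH]; first by rewrite !addn0; lia.
  rewrite !addnS; have := grow j; have := vS (k0 + j).+1.
  by have := D0 (k0 + j).+2; rewrite /N !mulnDl mul1n; lia.
(* By this index [u] has caught up with [v]; one more step creates an excess above [kappa * D],
   against [close]. *)
have := gain (v k0.+1); have := close (v k0.+1); have := grow (v k0.+1).
have := vS (k0 + v k0.+1).+1; have := D0 (k0 + v k0.+1).+2.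
by rewrite /N !mulnDl mul1n; lia.
Qed.


End Orbit.

(** Centring [t \o fi] costs two conjugators of length [drift] times its spread, and a factor [L]
    between the spreads. *)
Lemma generic_transfer N X :
  generic l S (2 * drift + L * N) X -> generic l S N (fi X)^-1.
Proof.
move=> XN t ti tA tC; rewrite (autV tA) (tl_inv lT).
have [z zC] := center_ex l S (t \o fi).
have zA := automorphism_conj z (automorphism_comp tA (aut_sym fA)).
have zt g : z^-1 * (t \o fi) (f g) * z = z^-1 * t g * z^-1^-1.
  by rewrite /= (autK fA) invgK.
have [_ le2 le3] := recenter tA zA tC zC zt.
have := XN _ _ zA zC; move: le2 le3; set D := spread _; set D' := spread _ => le2 le3.
rewrite /= (tl_inv lT) in le3 *.
have h1 := len_tri lT (z^-1 * t (fi X)) z; have h2 := len_tri lT z^-1 (t (fi X)).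
rewrite (tl_inv lT) in h2; rewrite mulnDl => h3.
have : (N * D <= L * N * D')%N by rewrite (mulnC L) -mulnA leq_mul2l le2 orbT.
have := leq_trans h1 (leq_add h2 (leqnn _)).
by move=> h4 h5; have := leq_trans h3 h4; lia.
Qed.

End Renormalization.

Lemma generic_mono (G : groupType) (l : G -> nat) S N N' X :
  (N' <= N)%N -> generic l S N X -> generic l S N' X.
Proof.
move=> leN XN t ti tA tC; apply: leq_trans (XN t ti tA tC).
by rewrite leq_mul2r leN orbT.
Qed.

Theorem twisted_classes_infinite (G : groupType) (l : G -> nat) (S : seq G)
    (f fi : G -> G) (cs : seq G) :
  tree_length l -> letter_gens l S -> branching l -> automorphism f fi ->
  exists X, forall c w, c \in cs -> X^-1 * f w <> w * c^-1.
Proof.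
move=> lT lS lB fA; have fiA := aut_sym fA.
have [L0 hL0] := aut_bound_seq lT lS (map f S ++ map fi S).
have [n hn] := aut_bound_seq lT lS (cs ++ [seq (fi c)^-1 | c <- cs]).
pose L := L0.+1.
have hL g : aut_bound l S L0 g -> aut_bound l S L g.
  by move=> gL t ti tA; apply: leq_trans (gL t ti tA) _; rewrite leq_mul2r leqnSn orbT.
have fL s : s \in S -> aut_bound l S L (f s).
  by move=> sS; apply/hL/hL0; rewrite mem_cat; apply/orP; left; apply: map_f.
have fiL s : s \in S -> aut_bound l S L (fi s).
  by move=> sS; apply/hL/hL0; rewrite mem_cat; apply/orP; right; apply: map_f.
pose M := stretch S L n.
have [X [Xgen Xcut]] := generic_ex lT lS lB (2 * drift L + L * M) fA.
exists X => c w cS eqX.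
have XM : generic l S M X.
  by apply: generic_mono Xgen; rewrite /L mulSn; lia.
(* If [w] is on the side of [X^-1], it is not on the side of [fi X], and the argument runs with
   [fi], [(fi X)^-1] and [(fi c)^-1]. *)
have [w0|w0] := posnP (gprod l 1 w X^-1).
  apply: (orbit_absurd lT lS lB fA (ltn0Sn L0) fL fiL _ XM Xcut w0 eqX).
  by apply: hn; rewrite mem_cat cS.
have wcut : gprod l 1 w ((fi X)^-1)^-1 = 0%N.
  rewrite invgK; apply: (@gprod0_trans _ _ lT _ X^-1); last by rewrite gprodC.
  exact: Xcut.
have X'cut : gprod l 1 ((fi X)^-1)^-1 (f (fi X)^-1) = 0%N.
  by rewrite invgK (autV fA) (autVK fA) (gprodC lT).
have X'gen := generic_transfer lT lS lB fA (ltn0Sn L0) fL fiL Xgen.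
have eqX' : ((fi X)^-1)^-1 * fi w = w * ((fi c)^-1)^-1.
  rewrite !invgK -(autM fiA) -{2}(autK fA w) -(autM fiA); congr fi.
  by rewrite -[f w](mulVKg X) eqX mulgA mulgVK.
apply: (orbit_absurd lT lS lB fiA (ltn0Sn L0) fiL fL _ X'gen X'cut wcut eqX').
by apply: hn; rewrite mem_cat; apply/orP; right; apply/mapP; exists c.
Qed.

(** * Normal forms in a free product *)

(** Permutations of any type: the group through which actions of the factors extend to [G] by the
    universal property. *)
Record sym (T : Type) := Sym {
  sym_fun :> T -> T;
  sym_inv : T -> T;
  sym_funK : cancel sym_fun sym_inv;
  sym_invK : cancel sym_inv sym_fun }.

Lemma sym_eq T (s s' : sym T) : s =1 s' -> s = s'.
Proof.
case: s s' => [f g fK gK] [f' g' fK' gK'] /= /funext eqf; subst f'.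
have eqg : g = g' by apply: funext => x; rewrite -{1}(gK' x) fK.
by subst g'; congr Sym; apply: Prop_irrelevance.
Qed.

HB.instance Definition _ T := gen_eqMixin (sym T).
HB.instance Definition _ T := gen_choiceMixin (sym T).

Section SymGroup.
Variable T : Type.

Definition sym_one : sym T := @Sym T id id (fun=> erefl) (fun=> erefl).
Definition sym_V (s : sym T) : sym T := Sym (@sym_invK _ s) (@sym_funK _ s).
Definition sym_mul (s s' : sym T) : sym T :=
  Sym (can_comp (@sym_funK _ s) (@sym_funK _ s'))
      (can_comp (@sym_invK _ s') (@sym_invK _ s)).

Lemma sym_mulA : associative sym_mul. Proof. by move=> *; apply: sym_eq. Qed.
Lemma sym_mul1 : left_id sym_one sym_mul. Proof. by move=> *; apply: sym_eq. Qed.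
Lemma sym_mulr1 : right_id sym_one sym_mul. Proof. by move=> *; apply: sym_eq. Qed.
Lemma sym_mulV : left_inverse sym_one sym_V sym_mul.
Proof. by move=> s; apply: sym_eq => x /=; rewrite sym_funK. Qed.
Lemma sym_mulrV : right_inverse sym_one sym_V sym_mul.
Proof. by move=> s; apply: sym_eq => x /=; rewrite sym_invK. Qed.

HB.instance Definition _ := isGroup.Build (sym T)
  sym_mulA sym_mul1 sym_mulr1 sym_mulV sym_mulrV.

Lemma symM (s s' : sym T) x : (s * s')%g x = s (s' x). Proof. by []. Qed.

End SymGroup.

Definition mul_morphism (G K : groupType) (f : G -> K)
    (fM : {morph f : x y / x * y}) : {multiplicative G -> K} :=
  HB.pack f (isMultiplicative.Build G K f fM).

Section LeftRegular.
Variables (G : groupType) (T : Type) (act : G -> T -> T).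
Hypotheses (act1 : forall x, act 1 x = x)
  (actM : forall g h x, act (g * h) x = act g (act h x)).

Lemma act_sym_subproof g : cancel (act g) (act g^-1).
Proof. by move=> x; rewrite -actM mulVg act1. Qed.

Lemma act_sym_subproofV g : cancel (act g^-1) (act g).
Proof. by move=> x; rewrite -actM mulgV act1. Qed.

Definition act_sym g := Sym (act_sym_subproof g) (act_sym_subproofV g).

Lemma act_symM : {morph act_sym : g h / g * h}.
Proof. by move=> g h; apply: sym_eq => x; rewrite /= actM. Qed.

Definition act_morphism : {multiplicative G -> sym T} := mul_morphism act_symM.

End LeftRegular.

Section FreeProduct.
Variables (G : groupType) (I : eqType) (H : I -> groupType).
Variable iota : forall i, {multiplicative H i -> G}.
Hypothesis freeG : is_free_product iota.

Lemma iota1 i : iota i 1 = 1.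
Proof. by apply: (@mulgI _ (iota i 1)); rewrite -gmulfM !mulg1. Qed.

Lemma iotaV i x : iota i x^-1 = (iota i x)^-1.
Proof. by apply: (@mulgI _ (iota i x)); rewrite -gmulfM !mulgV iota1. Qed.

(* Swapping the two copies of P in G * bool commutes with the factors, hence with
   G by uniqueness. *)
Lemma free_ind (P : G -> Prop) : P 1 ->
  (forall g i x, P g -> P (iota i x * g)) -> forall g, P g.
Proof.
move=> P1 Pi g.
pose lact (g : G) (x : G * bool) := (g * x.1, x.2).
have lact1 x : lact 1 x = x by rewrite /lact mul1g; case: x.
have lactM h k x : lact (h * k) x = lact h (lact k x) by rewrite /lact /= mulgA.
pose lam := act_morphism lact1 lactM.
pose swap (x : G * bool) := (x.1, x.2 (+) `[< P x.1 >]).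
have swapK : cancel swap swap by case=> x b; rewrite /swap /= addbK.
pose tau : sym (G * bool)%type := Sym swapK swapK.
have swapi i x : tau * lam (iota i x) = lam (iota i x) * tau.
  apply: sym_eq => -[y b]; rewrite !symM /= /swap /lact /=.
  congr (_, b (+) _); apply: asbool_equiv_eq; split=> [Pxy|]; last exact: Pi.
  by have := Pi _ i x^-1 Pxy; rewrite iotaV mulKg.
pose lam' (h : G) := tau * lam h * tau^-1.
have lam'M : {morph lam' : x y / x * y}.
  by move=> x y; rewrite /lam' gmulfM !mulgA mulgVK.
have [mu _ mu1] := freeG (fun i => mul_morphism (comp_gmulfM lam (iota i))).
have e1 := mu1 lam (fun i x => erefl) g.
have : mul_morphism lam'M g = mu g.
  by apply: mu1 => i x; rewrite /= /lam' swapi mulgK.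
rewrite -e1 /= /lam' => /(congr1 (fun s => (s * tau)%g (1, false))).
rewrite mulgVK !symM /= /swap /lact /= mulg1 => -[].
by rewrite (asboolT P1) => /asboolW.
Qed.

Local Notation letter := {i : I & H i}.
Implicit Types (w : seq letter) (a b : letter).

Definition reduced w :=
  all (fun a => tagged a != 1) w && sorted (fun a b => tag a != tag b) w.

Definition off i w := if w is a :: _ then tag a != i else true.

Lemma reduced_cons a w :
  reduced (a :: w) = [&& tagged a != 1, off (tag a) w & reduced w].
Proof.
rewrite /reduced; case: w => [|b w] /=; first by rewrite !andbT.
rewrite (eq_sym (tag b)); case: (tagged a != 1) => //=.
by case: (tag a != tag b); rewrite /= ?andbF.
Qed.

Definition split i w : H i * seq letter :=
  if w is a :: w' then
    match tag a =P i with
    | ReflectT e => (eq_rect _ (fun j => H j) (tagged a) _ e, w')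
    | _ => (1, w)
    end
  else (1, [::]).

Definition glue i (x : H i) w := if x == 1 then w else Tagged H x :: w.

Lemma split_off i w : off i w -> split i w = (1, w).
Proof. by case: w => //= a w; case: eqP. Qed.

Lemma split_cons i (x : H i) w : split i (Tagged H x :: w) = (x, w).
Proof. by rewrite /split /=; case: eqP => // e; rewrite (eq_irrelevance e erefl). Qed.

Lemma split_glue i (x : H i) w : off i w -> split i (glue x w) = (x, w).
Proof.
rewrite /glue; case: eqP => [-> /split_off //|_ _]; exact: split_cons.
Qed.

Lemma reduced_glue i (x : H i) w : off i w -> reduced w -> reduced (glue x w).
Proof.
by move=> wi wr; rewrite /glue; case: ifP => // x1; rewrite reduced_cons /= x1 wi.
Qed.

Variant split_spec i w : H i * seq letter -> Type :=
  SplitSpec x w' of off i w' & (reduced w -> reduced w') & 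
    (reduced w -> w = glue x w') : split_spec w (x, w').

Lemma splitP i w : reduced w -> split_spec w (split i w).
Proof.
case: w => [|[j y] w] wr; first by constructor => //; rewrite /glue eqxx.
have [e|ne] := eqVneq j i; last first.
  by rewrite split_off //; constructor => // _; rewrite /glue eqxx.
subst j; rewrite split_cons; move: (wr); rewrite reduced_cons /= => /and3P[y1 wi w'r].
by constructor => // _; rewrite /glue (negPf y1).
Qed.

(** This is van der Waerden's action of a factor on reduced words. *)
Definition act i (x : H i) w := glue (x * (split i w).1) (split i w).2.

Lemma act_reduced i (x : H i) w : reduced w -> reduced (act x w).
Proof.
move=> wr; rewrite /act; case: (splitP i wr) => y w' wi w'r _ /=.
by apply: reduced_glue => //; apply: w'r.
Qed.

Lemma act1 i w : reduced w -> act (1 : H i) w = w.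
Proof.
move=> wr; rewrite /act; case: (splitP i wr) => y w' wi w'r e /=.
by rewrite mul1g -e.
Qed.

Lemma actM i (x y : H i) w : reduced w -> act (x * y) w = act x (act y w).
Proof.
move=> wr; rewrite /act; case: (splitP i wr) => z w' wi _ _ /=.
by rewrite split_glue //= mulgA.
Qed.

Definition rword := {w | reduced w}.

Definition ract i (x : H i) (u : rword) : rword :=
  exist _ (act x (val u)) (act_reduced x (valP u)).

Lemma ract1 i u : ract (1 : H i) u = u.
Proof. by apply: val_inj; rewrite /= act1 // (valP u). Qed.

Lemma ractM i (x y : H i) u : ract (x * y) u = ract x (ract y u).
Proof. by apply: val_inj; rewrite /= actM // (valP u). Qed.

Definition eval w : G := foldr (fun a g => iota (tag a) (tagged a) * g) 1 w.

Lemma eval_glue i (x : H i) w : eval (glue x w) = iota i x * eval w.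
Proof. by rewrite /glue; case: eqP => [->|] //; rewrite iota1 mul1g. Qed.

Lemma eval_act i (x : H i) w : reduced w -> eval (act x w) = iota i x * eval w.
Proof.
move=> wr; rewrite /act; case: (splitP i wr) => y w' wi w'r e /=.
by rewrite e // !eval_glue gmulfM mulgA.
Qed.

Lemma act_cons a w : reduced (a :: w) -> act (tagged a) w = a :: w.
Proof.
rewrite reduced_cons => /and3P[a1 aw wr].
by rewrite /act split_off //= mulg1 /glue (negPf a1); case: a {a1 aw}.
Qed.

Lemma normal_form_ex : exists nf : G -> seq letter,
  [/\ forall g, reduced (nf g), forall g, eval (nf g) = g
    & forall w, reduced w -> nf (eval w) = w].
Proof.
have [mu muE _] := freeG (fun i => act_morphism (@ract1 i) (@ractM i)).
have nil_reduced : reduced [::] by [].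
(* The normal form of [g] is the image of the empty word under [g]. *)
pose nf g := val (mu g (exist _ [::] nil_reduced)).
have nfM i x g : nf (iota i x * g) = act x (nf g).
  by rewrite /nf gmulfM symM muE.
have nf1 : nf 1 = [::].
  rewrite /nf; have -> : mu 1 = 1 by apply: (@mulgI _ (mu 1)); rewrite -gmulfM !mulg1.
  by [].
have nfr g : reduced (nf g) by apply: valP.
exists nf; split=> // [|w].
  by apply: free_ind => [|g i x IH]; rewrite ?nf1 // nfM eval_act // IH.
elim: w => [_|a w IH awr] /=; first exact: nf1.
rewrite nfM IH ?act_cons //.
by move: awr; rewrite reduced_cons => /and3P[].
Qed.

End FreeProduct.

(** * Syllable length *)

Section SyllableLength.
Variables (G : groupType) (I : finType) (H : I -> groupType).
Variable iota : forall i, {multiplicative H i -> G}.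
Hypothesis splitG : nontrivial_free_product iota.
Local Notation letter := {i : I & H i}.
Local Notation eval := (eval iota).
Implicit Types (w u v : seq letter) (a b : letter).

Variable nf : G -> seq letter.
Hypothesis nfr : forall g, reduced (nf g).
Hypothesis nfK : forall g, eval (nf g) = g.
Hypothesis evalK : forall w, reduced w -> nf (eval w) = w.

Definition letterV a : letter := Tagged H (tagged a)^-1.

Fixpoint revcat u v := if u is a :: u' then revcat u' (letterV a :: v) else v.

Lemma size_revcat u v : size (revcat u v) = (size u + size v)%N.
Proof. by elim: u v => //= a u IH v; rewrite IH addnS. Qed.

Lemma eval_revcat u v : eval (revcat u v) = (eval u)^-1 * eval v.
Proof.
elim: u v => [|a u IH] v /=; first by rewrite invg1 mul1g.
by rewrite IH /= iotaV invgM mulgA.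
Qed.

Lemma reduced_revcat u v : reduced u -> reduced v ->
  (if u is a :: _ then off (tag a) v else true) -> reduced (revcat u v).
Proof.
elim: u v => //= a u IH v; rewrite reduced_cons => /and3P[a1 au ur] vr av.
apply: IH => //; first by rewrite reduced_cons /= invg_eq1 a1 av.
by case: u au {ur} => //= b u; rewrite eq_sym.
Qed.

(* Twice the length of the common prefix of u and v, plus 1 if the letters
   after it belong to the same factor. *)
Fixpoint overlap u v : nat :=
  match u, v with
  | a :: u', b :: v' =>
    if a == b then (overlap u' v').+2 else (tag a == tag b : nat)
  | _, _ => 0
  end.

Lemma overlap_ultra u v w :
  (minn (overlap u v) (overlap v w) <= overlap u w)%N.
Proof.
elim: u v w => [|a u IH] [|b v] [|c w] //=; rewrite ?min0n ?minn0 //.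
have [e|nab] := eqVneq a b; first subst b.
  have [e|nac] := eqVneq a c; first by subst c; have := IH v w; lia.
  by rewrite geq_minr.
have [e|nbc] := eqVneq b c; first by subst c; rewrite (negPf nab) geq_minl.
have [e|nac] := eqVneq a c; first by case: (tag a == _); case: (tag b == _).
case: eqP => [->|_]; last by rewrite min0n.
by rewrite geq_minr.
Qed.

Definition syllables g := size (nf g).

(** Equal letters of the prefix cancel in pairs, and two distinct letters of one factor merge into
    one. Thus [overlap] is the doubled Gromov product at 1. *)
Lemma overlap_dist g h :
  (dist syllables g h + overlap (nf g) (nf h) = syllables g + syllables h)%N.
Proof.
have red u v : reduced u -> reduced v ->
    (size (nf ((eval u)^-1 * eval v)) + overlap u v = size u + size v)%N.
  elim: u v => [|a u IH] v ur vr.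
    by rewrite /= invg1 mul1g evalK // addn0.
  case: v vr => [|b v] vr.
    rewrite -(eval_revcat (a :: u) [::]) evalK ?size_revcat ?addn0 //.
    exact: reduced_revcat.
  move: (ur) (vr); rewrite !reduced_cons => /and3P[a1 au ur'] /and3P[b1 bv vr'] /=.
  have [eab|nab] := eqVneq a b.
    subst b; have -> : (iota (tag a) (tagged a) * eval u)^-1 *
        (iota (tag a) (tagged a) * eval v) = (eval u)^-1 * eval v.
      by rewrite invgM -mulgA mulKg.
    by have := IH v ur' vr'; lia.
  have [tab|ntab] := eqVneq (tag a) (tag b); last first.
    rewrite -(eval_revcat (a :: u) (b :: v)) evalK ?size_revcat ?addn0 //.
    by apply: reduced_revcat => //=; rewrite eq_sym.
  case: a b tab nab a1 au b1 bv {ur vr} => [i x] [j y] /= eij; subst j => nab x1 au y1 bv.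
  rewrite invgM mulgA -(mulgA (eval u)^-1) -iotaV -gmulfM -mulgA.
  rewrite -[_ * eval v]/(eval (Tagged H (x^-1 * y)%g :: v)) -eval_revcat.
  have xy1 : x^-1 * y != 1.
    apply: contra_neqN nab; rewrite -(inj_eq (@mulgI _ x)) mulVKg mulg1.
    by move=> /eqP ->.
  rewrite evalK ?size_revcat /=; first by lia.
  apply: reduced_revcat => //; first by rewrite reduced_cons /= xy1 bv.
  by case: u au {IH ur'} => //= c u; rewrite eq_sym.
by have := red _ _ (nfr g) (nfr h); rewrite !nfK.
Qed.

Lemma nf1 : nf 1 = [::].
Proof. exact: (@evalK [::]). Qed.

Lemma syllables_tree : tree_length syllables.
Proof.
have sylV g : syllables g^-1 = syllables g.
  have e : eval (revcat (nf g) [::]) = g^-1 by rewrite eval_revcat nfK /= mulg1.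
  rewrite /syllables -e evalK ?size_revcat ?addn0 //; apply: reduced_revcat => //.
  by case: (nf g).
split=> [g||f g h|g r rg].
- split=> [/size0nil g0|->]; last by rewrite /syllables nf1.
  by rewrite -(nfK g) g0.
- exact: sylV.
- have := overlap_ultra (nf f) (nf g) (nf h).
  have := overlap_dist f g; have := overlap_dist g h; have := overlap_dist f h.
  by lia.
have := nfr g; rewrite /reduced -{1 2}(cat_take_drop r (nf g)) all_cat.
move=> /andP[/andP[a1 a2] /cat_sorted2[s1 s2]].
have tr : reduced (take r (nf g)) by rewrite /reduced a1 s1.
have dr : reduced (drop r (nf g)) by rewrite /reduced a2 s2.
exists (eval (take r (nf g))); split; first by rewrite /syllables evalK // size_takel.
have e : g = eval (take r (nf g)) * eval (drop r (nf g)).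
  rewrite -{1}(nfK g) -{1}(cat_take_drop r (nf g)).
  by elim: (take _ _) => [|b u IH] /=; rewrite ?mul1g // IH mulgA.
by rewrite /dist {2}e mulKg /syllables evalK // size_drop.
Qed.

Lemma letter_off w : exists2 a : letter, tagged a != 1 & off (tag a) w.
Proof.
case: splitG => /card_gt1P[i [j [_ _ nij]]] ntH _.
have [x /eqP x1] := ntH i; have [y /eqP y1] := ntH j.
case: w => [|b w]; first by exists (Tagged H x).
have [e|ne] := eqVneq (tag b) i; first by exists (Tagged H y) => //=; rewrite e.
by exists (Tagged H x).
Qed.

Lemma overlap_off a u w : off (tag a) w -> overlap (a :: u) w = 0%N.
Proof.
case: w => //= b w nba; have [e|_] := eqVneq a b; first by rewrite e eqxx in nba.
by rewrite eq_sym (negPf nba).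
Qed.

Lemma syllables_branching : branching syllables.
Proof.
have lT := syllables_tree => g h.
have [a a1 ag] := letter_off (nf g^-1); have [b b1 bh] := letter_off (nf h).
(* It must start like [a] and end like [b]; one letter does if they share a factor. *)
pose w := if tag a == tag b then [:: a] else [:: a; b].
have wr : reduced w.
  by rewrite /w; case: ifPn => ab; rewrite !reduced_cons /= ?a1 ?b1 //= eq_sym ab.
have wE : exists u, w = a :: u by rewrite /w; case: ifP; eexists.
have wV : exists c u, nf (eval w)^-1 = c :: u /\ tag c = tag b.
  have e : (eval w)^-1 = eval (revcat w [::]) by rewrite eval_revcat /= mulg1.
  rewrite e evalK; last by apply: reduced_revcat => //; case: (w).
  by rewrite /w; case: eqP => [ab|_] /=; eexists; eexists.
exists (eval w); split.
- by move=> w1; have := evalK wr; rewrite w1 nf1; case: wE => u ->.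
- have := overlap_dist g^-1 (eval w); rewrite /dist invgK evalK //.
  have [u e] := wE; rewrite {2}e.
  have -> : overlap (nf g^-1) (a :: u) = 0%N.
    have := overlap_off u ag; case: (nf g^-1) ag => //= c v.
    by rewrite eq_sym => nac; rewrite eq_sym; case: eqP => // _; rewrite eq_sym.
  by rewrite addn0 (tl_inv lT).
have [c [u [e tc]]] := wV; have := overlap_dist (eval w)^-1 h.
rewrite e overlap_off ?tc // /dist invgK addn0 => ->.
by rewrite (tl_inv lT).
Qed.

Lemma syllables_gens : finitely_generated G ->
  exists S : seq G, letter_gens syllables S.
Proof.
have lT := syllables_tree; move=> [s sG].
pose L := flatten [seq [seq iota (tag a) (tagged a) | a <- nf x] | x <- s].
pose S := L ++ [seq x^-1 | x <- L].
have SV x : x \in S -> x^-1 \in S.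
  rewrite !mem_cat => /orP[xL|/mapP[y yL ->]].
    by apply/orP; right; apply/mapP; exists x.
  by rewrite invgK yL.
have LE x a : x \in s -> a \in nf x -> iota (tag a) (tagged a) \in L.
  by move=> xs ax; apply/flatten_mapP; exists x => //; apply: map_f.
exists S; split=> // [x|P P1 PS g].
  have L1 y : y \in L -> (syllables y <= 1)%N.
    move=> /flatten_mapP[z zs /mapP[a az ->]].
    have ar : reduced [:: a].
      by have /andP[/allP/(_ a az) a1 _] := nfr z; rewrite reduced_cons /= a1.
    by have := evalK ar; rewrite /= mulg1 /syllables => ->.
  rewrite mem_cat => /orP[/L1 //|/mapP[y /L1 yL ->]].
  by rewrite (tl_inv lT).
(* Elements whose right multiplications, in both directions, preserve [P] form a subgroup; it
   contains [s]. *)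
pose Q : {pred G} := fun x => `[< forall k, P k -> P (k * x) /\ P (k * x^-1) >].
have QP x k : x \in Q -> P k -> P (k * x) /\ P (k * x^-1).
  by rewrite unfold_in => /asboolP; apply.
have Qclosed : group_closed Q.
  split=> [|x y xQ yQ]; rewrite unfold_in; apply/asboolP => k Pk.
    by rewrite invg1 mulg1.
  rewrite invgF !mulgA; split.
    by have [kx _] := QP x k xQ Pk; case: (QP y _ yQ kx).
  by have [ky _] := QP y k yQ Pk; case: (QP x _ xQ ky).
have sQ : {subset s <= Q}.
  move=> x xs; rewrite -(nfK x); have : {subset nf x <= nf x} by [].
  elim: {1 3}(nf x) => [_|a w IH aw]; first by case: Qclosed.
  apply: (group_closedM Qclosed); last by apply: IH => b bw; rewrite aw // inE bw orbT.
  have aS : iota (tag a) (tagged a) \in S by rewrite mem_cat (LE x) ?aw ?mem_head.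
  by rewrite unfold_in; apply/asboolP => k Pk; split; apply: PS => //; apply: SV.
by have [] := QP g 1 (sG Q Qclosed sQ g) P1; rewrite mul1g.
Qed.

End SyllableLength.

(** * Infinitely many twisted classes in a free product *)

Theorem theorem4p1p10 (G : groupType) (I : finType) (H : I -> groupType)
    (iota : forall i : I, {multiplicative H i -> G})
    (G_fg : finitely_generated G)
    (H_indec : forall i : I, indecomposable (H i))
    (G_split : nontrivial_free_product iota) :
  Rinfty G.
Proof.
have freeG : is_free_product iota by case: G_split.
have [nf [nfr nfK evalK]] := normal_form_ex freeG.
have lT := syllables_tree nfr nfK evalK.
have lB := syllables_branching G_split nfr nfK evalK.
have [S lS] := syllables_gens nfr nfK evalK G_fg.
move=> phi [psi phiK psiK].
have phiA : automorphism phi psi by split=> //; apply: gmulfM.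
pose F (x : G) := ([set y | twisted_conj phi x y])%classic.
rewrite /Rinfty_at -/F => /finite_seqP[cls eq_cls].
(* One representative per class; the default 1 is never reached, since every entry of [cls] is a
   class. *)
pose cs := [seq xget 1 (fun x => F x = A) | A <- cls].
have [X notX] := twisted_classes_infinite cs lT lS lB phiA.
have FX : F X \in cls.
  have : range F (F X) by exists X.
  by rewrite eq_cls.
pose c := xget 1 (fun x => F x = F X).
have Fc : F c = F X by apply: (@xgetPex _ 1 (fun x => F x = F X)); exists X.
have : F X X by exists 1; rewrite (aut1 phiA) mul1g invg1 mulg1.
rewrite -Fc => -[w eqX].
apply: (notX c w); first by apply/mapP; exists (F X).
by rewrite -eqX !invgM invgK -!mulgA mulVg mulg1.
Qed.
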